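(* Let $X$ be a $0$-reduced simplicial set. Then the map $\psi:CGX\to\hat\Omega CX$ (defined in the context) is an algebra homomorphism, where $CGX$ has the shuffle multiplication $m$.
   Context: A simplicial set $X$ is $0$-reduced if $X_0$ is a single point $*$. For $x\in X_n$ and a monotone map $f:\{0,\dots,m\}\to\{0,\dots,n\}$, $x_{(f(0),\dots,f(m))}\in X_m$ denotes the corresponding simplex. Normalised chains: $C_nX$ is the free abelian group on the nondegenerate $n$-simplices (degenerate simplices are identified with $0$); $CGX$ is the normalised chain complex of the simplicial set underlying $GX$. Extended cobar construction $\hat\Omega CX$: its underlying graded ring (product written $\otimes$) is generated by symbols $s^{-1}x$ of degree $n-1$ for each nondegenerate $x\in X_n$, $n\ge1$, and $\xi_x$ of degree $0$ for each nondegenerate $x\in X_1$, subject only to the relations that $\xi_x$ is a two-sided inverse of $1+s^{-1}x$ for nondegenerate $x\in X_1$. Conventions: $s^{-1}y=0$ if $y$ is degenerate, and $\xi_{s_0*}=1$. Kan loop group: $GX$ is the simplicial group with $(GX)_n=\mathbf F(X_{n+1})/\mathbf F(s_0X_n)$ ($\mathbf F$ = free group); writing $\tau x\in (GX)_n$ for the class of $x\in X_{n+1}$ (so $\tau s_0x=1$), the simplicial structure is determined by $s_i\tau x=\tau s_{i+1}x$ for $i\ge0$, $d_0\tau x=(\tau d_0x)^{-1}\cdot\tau d_1x$, and $d_i\tau x=\tau d_{i+1}x$ for $i\ge1$. Multiplication on $CGX$: for $g\in (GX)_p$, $h\in (GX)_q$, $$m(g\otimes h)=\sum(-1)^{\mathrm{sgn}(\mu,\nu)}s_{\mu(q)}\cdots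 s_{\mu(1)}g\cdot s_{\nu(p)}\cdots s_{\nu(1)}h,$$ the sum being over all $(p,q)$-shuffles, i.e. partitions of $\{0,\dots,p+q-1\}$ into $\nu(1)<\dots<\nu(p)$ and $\mu(1)<\dots<\mu(q)$, with $\mathrm{sgn}(\mu,\nu)$ the parity of the permutation $(\nu(1),\dots,\nu(p),\mu(1),\dots,\mu(q))$. Retraction map: $\psi:CGX\to\hat\Omega CX$ is the unique family of linear maps $\psi_n:C_nGX\to(\hat\Omega CX)_n$ with $\psi_0(1)=1$ and, for all $n\ge0$, $x\in X_{n+1}$, $g\in (GX)_n$, $$\psi_n(\tau x\cdot g)=\psi_n(g)-\sum_{i=0}^n s^{-1}x_{(0,\dots,i+1)}\otimes\psi_{n-i}(\tau d_1^ix\cdot d_0^ig).$$ *)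

(* Defs.v *)
From HB Require Import structures.
From mathcomp Require Import all_boot all_order all_algebra all_fingroup.
From mathcomp Require Import boolp zify.
From mathcomp Require Import generic_quotient freeg.

Set Implicit Arguments.
Unset Strict Implicit.
Unset Printing Implicit Defensive.

Import GRing.Theory.

Local Open Scope ring_scope.
Local Open Scope quotient_scope.

(* The structure maps are indexed by ordinals, so that there is one operator
   for each index that makes sense and no other; the simplicial identities are
   stated through [inord], with explicit ranges. *)
Record sset := Sset {
  simplex :> nat -> Type;
  face_map : forall n, 'I_n.+2 -> simplex n.+1 -> simplex n;
  degen_map : forall n, 'I_n.+1 -> simplex n -> simplex n.+1;
  face_face_subproof : forall n i j (x : simplex n.+2),
    (i < j <= n.+2)%N ->
    face_map (inord i) (face_map (inord j) x) =
    face_map (inord j.-1) (face_map (inord i) x);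
  degen_degen_subproof : forall n i j (x : simplex n),
    (i <= j <= n)%N ->
    degen_map (inord i) (degen_map (inord j) x) =
    degen_map (inord j.+1) (degen_map (inord i) x);
  face_degen_lt_subproof : forall n i j (x : simplex n.+1),
    (i < j <= n.+1)%N ->
    face_map (inord i) (degen_map (inord j) x) =
    degen_map (inord j.-1) (face_map (inord i) x);
  face_degen_id_subproof : forall n i j (x : simplex n),
    (j <= i <= j.+1)%N -> (j <= n)%N ->
    face_map (inord i) (degen_map (inord j) x) = x;
  face_degen_gt_subproof : forall n i j (x : simplex n.+1),
    (j.+1 < i <= n.+2)%N ->
    face_map (inord i) (degen_map (inord j) x) =
    degen_map (inord j) (face_map (inord i.-1) x)
}.

Section Operators.
Variable X : sset.

Definition face (i n : nat) (x : X n.+1) : X n := face_map (inord i) x.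
Definition degen (i n : nat) (x : X n) : X n.+1 := degen_map (inord i) x.

Lemma face_face n i j (x : X n.+2) : (i < j <= n.+2)%N ->
  face i (face j x) = face j.-1 (face i x).
Proof. exact: face_face_subproof. Qed.

Lemma degen_degen n i j (x : X n) : (i <= j <= n)%N ->
  degen i (degen j x) = degen j.+1 (degen i x).
Proof. exact: degen_degen_subproof. Qed.

Lemma face_degen_lt n i j (x : X n.+1) : (i < j <= n.+1)%N ->
  face i (degen j x) = degen j.-1 (face i x).
Proof. exact: face_degen_lt_subproof. Qed.

Lemma face_degen_id n i j (x : X n) : (j <= i <= j.+1)%N -> (j <= n)%N ->
  face i (degen j x) = x.
Proof. exact: face_degen_id_subproof. Qed.

Lemma face_degen_gt n i j (x : X n.+1) : (j.+1 < i <= n.+2)%N ->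
  face i (degen j x) = degen j (face i.-1 x).
Proof. exact: face_degen_gt_subproof. Qed.

Definition zero_reduced : Prop := exists pt : X 0%N, forall x : X 0%N, x = pt.

Inductive degenerate : forall n, X n -> Prop :=
  Degenerate n (i : 'I_n.+1) (x : X n) : degenerate (degen_map i x).

Definition nondegenerate n : pred {classic X n} :=
  fun x => ~~ `[< degenerate x >].

(* d_0 applied i times; only meaningful for i <= n, as are the next two *)
Fixpoint iter_face0 (i n : nat) : X n -> X (n - i)%N :=
  match n, i with
  | n'.+1, i'.+1 => fun x => iter_face0 i' (face 0 x)
  | 0, _ | _, 0 => fun x => x
  end.

Fixpoint iter_face1 (i n : nat) : X n.+1 -> X (n - i).+1 :=
  match n, i with
  | n'.+1, i'.+1 => fun x : X n'.+2 => iter_face1 i' (face 1 x)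
  | 0, _ | _, 0 => fun x => x
  end.

Fixpoint iter_face_last (i n : nat) : X n.+1 -> X (n - i).+1 :=
  match n, i with
  | n'.+1, i'.+1 => fun x : X n'.+2 => iter_face_last i' (face n'.+2 x)
  | 0, _ | _, 0 => fun x => x
  end.

(* The front face x_(0,...,i+1) of an (n+1)-simplex x, for i <= n: drop the
   last n - i vertices.  It lives in X_(i+1), because n - (n - i) = i. *)
Definition front (i n : nat) (x : X n.+1) : X (n - (n - i)).+1 :=
  iter_face_last (n - i) x.

(* s_(mu (k-1)) ... s_(mu 0) x *)
Fixpoint iter_degen (k n : nat) : ('I_k -> nat) -> X n -> X (k + n)%N :=
  match k with
  | 0 => fun _ x => x
  | k'.+1 => fun mu x =>
      degen (mu ord_max) (iter_degen (fun i => mu (widen_ord (leqnSn k') i)) x)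
  end.

Definition cast_simplex m n (e : m = n) (x : X m) : X n := ecast k (X k) e x.

End Operators.

Arguments face {X} i {n} x : simpl never.
Arguments degen {X} i {n} x : simpl never.
Arguments iter_face0 {X} i {n} x.
Arguments iter_face1 {X} i {n} x.
Arguments iter_face_last {X} i {n} x.
Arguments front {X} i {n} x.
Arguments nondegenerate X n x : clear implicits.

Definition nsimplex (X : sset) (n : nat) :=
  {x : {classic X n} | nondegenerate X n x}.

HB.instance Definition _ X n := SubChoice.on (nsimplex X n).

Definition nchain (X : sset) (n : nat) := {freeg (nsimplex X n) / int}.

HB.instance Definition _ X n := GRing.Lmodule.on (nchain X n).

Definition chain (X : sset) (n : nat) (x : X n) : nchain X n :=
  if (insub (x : {classic X n}) : option (nsimplex X n)) is Some y
  then << y >> else 0.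

Section PresentedGroup.
Variables (S : Type) (K : S -> Prop).

(* (x, false) stands for x and (x, true) for its inverse *)
Definition gword := {classic seq (S * bool)}.

Inductive gword_eq : gword -> gword -> Prop :=
| GwRefl u : gword_eq u u
| GwSym u v : gword_eq u v -> gword_eq v u
| GwTrans u v w : gword_eq u v -> gword_eq v w -> gword_eq u w
| GwCancel u v x b : gword_eq (u ++ (x, b) :: (x, ~~ b) :: v) (u ++ v)
| GwKill u v x b : K x -> gword_eq (u ++ (x, b) :: v) (u ++ v).

Definition gword_eqb : rel gword := fun u v => `[< gword_eq u v >].

Lemma gword_eqb_refl : reflexive gword_eqb.
Proof. by move=> u; apply/asboolP/GwRefl. Qed.

Lemma gword_eqb_sym : symmetric gword_eqb.
Proof. by move=> u v; apply/asboolP/asboolP; apply: GwSym. Qed.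

Lemma gword_eqb_trans : transitive gword_eqb.
Proof.
by move=> v u w /asboolP uv /asboolP vw; apply/asboolP/(GwTrans uv vw).
Qed.

Canonical gword_equiv :=
  EquivRel gword_eqb gword_eqb_refl gword_eqb_sym gword_eqb_trans.

(* F(S)/F(K): the quotient of the free group on S by the normal closure of K *)
Definition pgroup := {eq_quot gword_eqb}.
HB.instance Definition _ := Choice.on pgroup.
HB.instance Definition _ := Quotient.on pgroup.

Lemma pgroup_eqP (u v : gword) :
  reflect (gword_eq u v) (\pi_pgroup u == \pi_pgroup v).
Proof. by rewrite eqmodE; apply: asboolP. Qed.

Definition gword_inv (u : gword) : gword :=
  [seq (l.1, ~~ l.2) | l <- rev u].

Definition pgroup_one : pgroup := \pi_pgroup ([::] : gword).
Definition pgroup_mul (a b : pgroup) : pgroup :=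
  \pi_pgroup (repr a ++ repr b : gword).
Definition pgroup_inv (a : pgroup) : pgroup := \pi_pgroup (gword_inv (repr a)).

Lemma gword_eq_cat u v u' v' :
  gword_eq u u' -> gword_eq v v' -> gword_eq (u ++ v) (u' ++ v').
Proof.
move=> uu' vv'; apply: (@GwTrans _ (u ++ v')).
- elim: vv' => {v v'} [v|v w _|v w z _ vw _ wz|v w x b|v w x b Kx].
  + exact: GwRefl.
  + exact: GwSym.
  + exact: GwTrans vw wz.
  + by rewrite !catA; apply: GwCancel.
  + by rewrite !catA; apply: GwKill.
- elim: uu' => {u u'} [u|u w _|u w z _ vw _ wz|u w x b|u w x b Kx].
  + exact: GwRefl.
  + exact: GwSym.
  + exact: GwTrans vw wz.
  + by rewrite -!catA; apply: GwCancel.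
  + by rewrite -!catA; apply: GwKill.
Qed.

Lemma gword_inv_cat (u v : gword) :
  gword_inv (u ++ v) = gword_inv v ++ gword_inv u.
Proof. by rewrite /gword_inv rev_cat map_cat. Qed.

Lemma gword_eq_inv u v : gword_eq u v -> gword_eq (gword_inv u) (gword_inv v).
Proof.
elim=> {u v} [u|u w _|u w z _ vw _ wz|u w x b|u w x b Kx].
- exact: GwRefl.
- exact: GwSym.
- exact: GwTrans vw wz.
- rewrite !gword_inv_cat -[_ :: _ :: w]/([:: (x, b); (x, ~~ b)] ++ w).
  rewrite gword_inv_cat -catA /gword_inv /= negbK.
  by have := GwCancel (gword_inv w) (gword_inv u) x b.
- rewrite !gword_inv_cat -[_ :: w]/([:: (x, b)] ++ w) gword_inv_cat -catA.
  exact: GwKill.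
Qed.

Lemma repr_gword_eq (u : gword) : gword_eq (repr (\pi_pgroup u)) u.
Proof. by apply/pgroup_eqP; rewrite reprK. Qed.

Lemma pgroup_mul_pi (u v : gword) :
  pgroup_mul (\pi u) (\pi v) = \pi_pgroup (u ++ v).
Proof. by apply/eqP/pgroup_eqP/gword_eq_cat; apply: repr_gword_eq. Qed.

Lemma pgroup_inv_pi (u : gword) : pgroup_inv (\pi u) = \pi_pgroup (gword_inv u).
Proof. exact/eqP/pgroup_eqP/gword_eq_inv/repr_gword_eq. Qed.

Lemma pgroup_mulA : associative pgroup_mul.
Proof.
by elim/quotW=> u; elim/quotW=> v; elim/quotW=> w; rewrite !pgroup_mul_pi catA.
Qed.

Lemma pgroup_mul1g : left_id pgroup_one pgroup_mul.
Proof. by elim/quotW=> u; rewrite pgroup_mul_pi. Qed.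

Lemma pgroup_mulg1 : right_id pgroup_one pgroup_mul.
Proof. by elim/quotW=> u; rewrite pgroup_mul_pi cats0. Qed.

Lemma gword_invK : involutive gword_inv.
Proof.
move=> u; rewrite /gword_inv -map_rev revK -map_comp -[RHS]map_id.
by apply: eq_map => -[x b] /=; rewrite negbK.
Qed.

Lemma pgroup_mulgV : right_inverse pgroup_one pgroup_inv pgroup_mul.
Proof.
elim/quotW=> u; rewrite pgroup_inv_pi pgroup_mul_pi; apply/eqP/pgroup_eqP.
elim: u => [|[x b] u IH]; first exact: GwRefl.
rewrite -[_ :: u]/([:: (x, b)] ++ u) gword_inv_cat -catA.
apply: (@GwTrans _ [:: (x, b); (x, ~~ b)]); last first.
  by have := GwCancel [::] [::] x b.
apply: (gword_eq_cat (GwRefl _)); rewrite catA.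
exact: (gword_eq_cat IH (GwRefl _)).
Qed.

Lemma pgroup_mulVg : left_inverse pgroup_one pgroup_inv pgroup_mul.
Proof.
elim/quotW=> u; rewrite -{2}(gword_invK u) -(pgroup_inv_pi (gword_inv u)).
by rewrite pgroup_inv_pi pgroup_mulgV.
Qed.

HB.instance Definition _ := isGroup.Build pgroup
  pgroup_mulA pgroup_mul1g pgroup_mulg1 pgroup_mulVg pgroup_mulgV.

Definition pgen (x : S) : pgroup := \pi [:: (x, false)].

Lemma pgen_kill x : K x -> pgen x = 1%g.
Proof. by move=> Kx; apply/eqP/pgroup_eqP; have := GwKill [::] [::] false Kx. Qed.

Lemma pgenV x : (pgen x)^-1%g = \pi_pgroup [:: (x, true)].
Proof. by rewrite [LHS]pgroup_inv_pi. Qed.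

Lemma pi_cons x b (u : gword) : \pi_pgroup ((x, b) :: u) =
  ((if b then (pgen x)^-1 else pgen x) * \pi_pgroup u)%g.
Proof.
rewrite -[_ :: u]/([:: (x, b)] ++ u) -pgroup_mul_pi.
by case: b; rewrite ?pgenV.
Qed.

Lemma pgroup_ind (P : pgroup -> Prop) : P 1%g ->
  (forall x a, P a -> P (pgen x * a)%g) ->
  (forall x a, P a -> P ((pgen x)^-1 * a)%g) -> forall a, P a.
Proof.
move=> P1 PM PV; elim/quotW; elim=> [|[x b] u IH] //.
by rewrite pi_cons; case: b; [apply: PV | apply: PM].
Qed.

Section Lift.
Variables (G : groupType) (f : S -> G).

Definition gword_eval (u : gword) : G :=
  foldr (fun l y => (if l.2 then (f l.1)^-1 else f l.1) * y)%g 1%g u.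

(* the homomorphism extending f, provided f is trivial on K *)
Definition pgroup_lift (a : pgroup) : G := gword_eval (repr a).

Lemma gword_eval_cat (u v : gword) :
  gword_eval (u ++ v) = (gword_eval u * gword_eval v)%g.
Proof. by elim: u => [|l u IH] /=; rewrite ?mul1g // IH mulgA. Qed.

Hypothesis fK : forall x, K x -> f x = 1%g.

Lemma gword_eval_eq u v : gword_eq u v -> gword_eval u = gword_eval v.
Proof.
elim=> {u v} [u|u w _|u w z _ -> _ ->|u w x b|u w x b Kx] //.
- by rewrite !gword_eval_cat /=; case: b; rewrite /= ?mulVKg ?mulKg.
- by rewrite !gword_eval_cat /= (fK Kx) invg1 if_same mul1g.
Qed.

Lemma pgroup_lift_pi (u : gword) : pgroup_lift (\pi u) = gword_eval u.
Proof. exact/gword_eval_eq/repr_gword_eq. Qed.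

Lemma pgroup_lift1 : pgroup_lift 1%g = 1%g.
Proof. by rewrite [LHS]pgroup_lift_pi. Qed.

Lemma pgroup_lift_gen x : pgroup_lift (pgen x) = f x.
Proof. by rewrite pgroup_lift_pi /= mulg1. Qed.

Lemma pgroup_liftM : {morph pgroup_lift : a b / (a * b)%g}.
Proof.
elim/quotW=> u; elim/quotW=> v.
by rewrite [(_ * _)%g]pgroup_mul_pi !pgroup_lift_pi gword_eval_cat.
Qed.

Lemma pgroup_liftV a : pgroup_lift (a^-1)%g = (pgroup_lift a)^-1%g.
Proof.
by apply: (mulgI (pgroup_lift a)); rewrite -pgroup_liftM !mulgV pgroup_lift1.
Qed.

End Lift.

End PresentedGroup.

Inductive ring_expr (S : Type) : Type :=
| RGen of S
| RZero
| ROne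
| ROpp of ring_expr S
| RAdd of ring_expr S & ring_expr S
| RMul of ring_expr S & ring_expr S.

Arguments RZero {S}.
Arguments ROne {S}.

Section PresentedRing.
Variables (S : Type) (Rel : ring_expr S -> ring_expr S -> Prop).

Inductive rexpr_eq : ring_expr S -> ring_expr S -> Prop :=
| ReRel a b : Rel a b -> rexpr_eq a b
| ReRefl a : rexpr_eq a a
| ReSym a b : rexpr_eq a b -> rexpr_eq b a
| ReTrans a b c : rexpr_eq a b -> rexpr_eq b c -> rexpr_eq a c
| ReOpp a b : rexpr_eq a b -> rexpr_eq (ROpp a) (ROpp b)
| ReAdd a b c d :
    rexpr_eq a b -> rexpr_eq c d -> rexpr_eq (RAdd a c) (RAdd b d)
| ReMul a b c d :
    rexpr_eq a b -> rexpr_eq c d -> rexpr_eq (RMul a c) (RMul b d)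
| ReAddA a b c : rexpr_eq (RAdd a (RAdd b c)) (RAdd (RAdd a b) c)
| ReAddC a b : rexpr_eq (RAdd a b) (RAdd b a)
| ReAdd0 a : rexpr_eq (RAdd RZero a) a
| ReAddN a : rexpr_eq (RAdd (ROpp a) a) RZero
| ReMulA a b c : rexpr_eq (RMul a (RMul b c)) (RMul (RMul a b) c)
| ReMul1l a : rexpr_eq (RMul ROne a) a
| ReMul1r a : rexpr_eq (RMul a ROne) a
| ReMulDl a b c : rexpr_eq (RMul (RAdd a b) c) (RAdd (RMul a c) (RMul b c))
| ReMulDr a b c : rexpr_eq (RMul a (RAdd b c)) (RAdd (RMul a b) (RMul a c)).

Definition rexpr := {classic ring_expr S}.
Definition rexpr_eqb : rel rexpr := fun a b => `[< rexpr_eq a b >].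

Lemma rexpr_eqb_refl : reflexive rexpr_eqb.
Proof. by move=> a; apply/asboolP/ReRefl. Qed.

Lemma rexpr_eqb_sym : symmetric rexpr_eqb.
Proof. by move=> a b; apply/asboolP/asboolP; apply: ReSym. Qed.

Lemma rexpr_eqb_trans : transitive rexpr_eqb.
Proof.
by move=> b a c /asboolP ab /asboolP bc; apply/asboolP/(ReTrans ab bc).
Qed.

Canonical rexpr_equiv :=
  EquivRel rexpr_eqb rexpr_eqb_refl rexpr_eqb_sym rexpr_eqb_trans.

Definition pring := {eq_quot rexpr_eqb}.
HB.instance Definition _ := Choice.on pring.
HB.instance Definition _ := Quotient.on pring.

Definition rclass (a : ring_expr S) : pring := \pi_pring (a : rexpr).

Lemma rclass_eqP a b : rexpr_eq a b <-> rclass a = rclass b.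
Proof.
by split=> [ab|/eqP]; [apply/eqP|]; rewrite eqmodE; [apply/asboolP | move/asboolP].
Qed.

Definition pring_opp (a : pring) : pring := rclass (ROpp (repr a)).
Definition pring_add (a b : pring) : pring := rclass (RAdd (repr a) (repr b)).
Definition pring_mul (a b : pring) : pring := rclass (RMul (repr a) (repr b)).

Lemma repr_rclass a : rexpr_eq (repr (rclass a)) a.
Proof. by apply/rclass_eqP; rewrite /rclass reprK. Qed.

Lemma pring_oppE a : pring_opp (rclass a) = rclass (ROpp a).
Proof. exact/rclass_eqP/ReOpp/repr_rclass. Qed.

Lemma pring_addE a b : pring_add (rclass a) (rclass b) = rclass (RAdd a b).
Proof. by apply/rclass_eqP/ReAdd; apply: repr_rclass. Qed.

Lemma pring_mulE a b : pring_mul (rclass a) (rclass b) = rclass (RMul a b).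
Proof. by apply/rclass_eqP/ReMul; apply: repr_rclass. Qed.

Lemma rclassW (P : pring -> Prop) : (forall a, P (rclass a)) -> forall a, P a.
Proof. exact: quotW. Qed.

Let pringE := (pring_oppE, pring_addE, pring_mulE).

Lemma pring_addA : associative pring_add.
Proof.
elim/rclassW=> a; elim/rclassW=> b; elim/rclassW=> c; rewrite !pringE.
exact/rclass_eqP/ReAddA.
Qed.

Lemma pring_addC : commutative pring_add.
Proof.
elim/rclassW=> a; elim/rclassW=> b; rewrite !pringE.
exact/rclass_eqP/ReAddC.
Qed.

Lemma pring_add0 : left_id (rclass RZero) pring_add.
Proof. elim/rclassW=> a; rewrite !pringE; exact/rclass_eqP/ReAdd0. Qed.

Lemma pring_addN : left_inverse (rclass RZero) pring_opp pring_add.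
Proof. elim/rclassW=> a; rewrite !pringE; exact/rclass_eqP/ReAddN. Qed.

Lemma pring_mulA : associative pring_mul.
Proof.
elim/rclassW=> a; elim/rclassW=> b; elim/rclassW=> c; rewrite !pringE.
exact/rclass_eqP/ReMulA.
Qed.

Lemma pring_mul1l : left_id (rclass ROne) pring_mul.
Proof. elim/rclassW=> a; rewrite !pringE; exact/rclass_eqP/ReMul1l. Qed.

Lemma pring_mul1r : right_id (rclass ROne) pring_mul.
Proof. elim/rclassW=> a; rewrite !pringE; exact/rclass_eqP/ReMul1r. Qed.

Lemma pring_mulDl : left_distributive pring_mul pring_add.
Proof.
elim/rclassW=> a; elim/rclassW=> b; elim/rclassW=> c; rewrite !pringE.
exact/rclass_eqP/ReMulDl.
Qed.

Lemma pring_mulDr : right_distributive pring_mul pring_add.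
Proof.
elim/rclassW=> a; elim/rclassW=> b; elim/rclassW=> c; rewrite !pringE.
exact/rclass_eqP/ReMulDr.
Qed.

HB.instance Definition _ := GRing.isPzRing.Build pring
  pring_addA pring_addC pring_add0 pring_addN pring_mulA
  pring_mul1l pring_mul1r pring_mulDl pring_mulDr.

Lemma rclass0 : rclass RZero = 0. Proof. by []. Qed.
Lemma rclass1 : rclass ROne = 1. Proof. by []. Qed.
Lemma rclassN a : rclass (ROpp a) = - rclass a.
Proof. by rewrite -pring_oppE. Qed.
Lemma rclassD a b : rclass (RAdd a b) = rclass a + rclass b.
Proof. by rewrite -pring_addE. Qed.
Lemma rclassM a b : rclass (RMul a b) = rclass a * rclass b.
Proof. by rewrite -pring_mulE. Qed.

End PresentedRing.

Inductive cobar_gen (X : sset) : Type :=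
| Desusp n of nsimplex X n.+1
| Xi of nsimplex X 1.

Inductive cobar_rel (X : sset) :
    ring_expr (cobar_gen X) -> ring_expr (cobar_gen X) -> Prop :=
| XiLeft x :
    cobar_rel (RMul (RGen (Xi x)) (RAdd ROne (RGen (Desusp x)))) ROne
| XiRight x :
    cobar_rel (RMul (RAdd ROne (RGen (Desusp x))) (RGen (Xi x))) ROne.

Definition cobar (X : sset) := pring (@cobar_rel X).
HB.instance Definition _ X := GRing.PzRing.on (cobar X).

Section Cobar.
Variable X : sset.

(* s^-1 x, in degree n for x in X_(n+1), with s^-1 x = 0 for degenerate x *)
Definition desusp n (x : X n.+1) : cobar X :=
  if insub (x : {classic X n.+1}) is Some y
  then rclass (@cobar_rel X) (RGen (Desusp y)) else 0.

(* xi_x = 1 for degenerate x, i.e. for x = s_0 * if X is 0-reduced *)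
Definition xi (x : X 1%N) : cobar X :=
  if insub (x : {classic X 1%N}) is Some y
  then rclass (@cobar_rel X) (RGen (Xi y)) else 1.

(* The homogeneous part of degree n: as the relations are homogeneous, it is
   the additive group spanned by the products of generators of total degree
   n. *)
Inductive cobar_deg : nat -> cobar X -> Prop :=
| CdDesusp n (x : X n.+1) : cobar_deg n (desusp x)
| CdXi (x : X 1%N) : cobar_deg 0%N (xi x)
| CdOne : cobar_deg 0%N 1
| CdMul m n a b :
    cobar_deg m a -> cobar_deg n b -> cobar_deg (m + n)%N (a * b)
| CdZero n : cobar_deg n 0
| CdOpp n a : cobar_deg n a -> cobar_deg n (- a)
| CdAdd n a b : cobar_deg n a -> cobar_deg n b -> cobar_deg n (a + b).

Lemma desusp_degen n (x : X n.+1) : degenerate x -> desusp x = 0.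
Proof. by move=> dx; rewrite /desusp insubF // /nondegenerate asboolT. Qed.

Lemma xiM (x : X 1%N) : xi x * (1 + desusp x) = 1.
Proof.
rewrite /xi /desusp; case: insubP => [y _ _|]; last by rewrite addr0 mul1r.
by rewrite -rclass1 -rclassD -rclassM; apply/rclass_eqP/ReRel/XiLeft.
Qed.

Lemma Mxi (x : X 1%N) : (1 + desusp x) * xi x = 1.
Proof.
rewrite /xi /desusp; case: insubP => [y _ _|]; last by rewrite addr0 mulr1.
by rewrite -rclass1 -rclassD -rclassM; apply/rclass_eqP/ReRel/XiRight.
Qed.

End Cobar.

Section LoopGroup.
Variable X : sset.

(* (GX)_n = F(X_(n+1)) / F(s_0 X_n); only s_0 is killed, the other degenerate
   simplices remain generators *)
Definition loop (n : nat) :=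
  pgroup (fun x : X n.+1 => exists y : X n, x = degen 0 y).
HB.instance Definition _ n := Group.on (loop n).

Definition tau n (x : X n.+1) : loop n := pgen _ x.

Definition loop_face_gen n (i : 'I_n.+2) (x : X n.+2) : loop n :=
  if i == 0%N :> nat then ((tau (face 0 x))^-1 * tau (face 1 x))%g
  else tau (face i.+1 x).

Definition loop_face n (i : 'I_n.+2) : loop n.+1 -> loop n :=
  pgroup_lift (loop_face_gen i).

Definition loop_degen n (i : 'I_n.+1) : loop n -> loop n.+1 :=
  pgroup_lift (fun x => tau (degen i.+1 x)).

Lemma tau_degen0 n (y : X n) : tau (degen 0 y) = 1%g.
Proof. by apply: pgen_kill; exists y. Qed.

Lemma loop_face_gen_degen0 n (i : 'I_n.+2) (x : X n.+2) :
  (exists y, x = degen 0 y) -> loop_face_gen i x = 1%g.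
Proof.
case=> y ->; rewrite /loop_face_gen; case: eqP => [_|i0].
  by rewrite !face_degen_id // mulVg.
rewrite face_degen_gt ?tau_degen0 //; apply/andP; split.
  by rewrite ltnS lt0n; apply/eqP.
exact: ltn_ord i.
Qed.

Lemma loop_degen_gen_degen0 n (i : 'I_n.+1) (x : X n.+1) :
  (exists y, x = degen 0 y) -> tau (degen i.+1 x) = 1%g.
Proof.
by case=> y ->; rewrite -degen_degen ?tau_degen0 //; exact: ltn_ord i.
Qed.

Lemma loop_faceM n (i : 'I_n.+2) : {morph loop_face i : a b / (a * b)%g}.
Proof. exact: pgroup_liftM (@loop_face_gen_degen0 n i). Qed.

Lemma loop_faceV n (i : 'I_n.+2) a :
  loop_face i (a^-1)%g = ((loop_face i a)^-1)%g.
Proof. exact: pgroup_liftV (@loop_face_gen_degen0 n i) _. Qed.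

Lemma loop_face1 n (i : 'I_n.+2) : loop_face i 1%g = 1%g.
Proof. exact: pgroup_lift1 (@loop_face_gen_degen0 n i). Qed.

Lemma loop_degenM n (i : 'I_n.+1) : {morph loop_degen i : a b / (a * b)%g}.
Proof. exact: pgroup_liftM (@loop_degen_gen_degen0 n i). Qed.

Lemma loop_degenV n (i : 'I_n.+1) a :
  loop_degen i (a^-1)%g = ((loop_degen i a)^-1)%g.
Proof. exact: pgroup_liftV (@loop_degen_gen_degen0 n i) _. Qed.

Lemma loop_degen1 n (i : 'I_n.+1) : loop_degen i 1%g = 1%g.
Proof. exact: pgroup_lift1 (@loop_degen_gen_degen0 n i). Qed.

Lemma loop_face0_tau n (x : X n.+2) :
  loop_face (inord 0) (tau x) = ((tau (face 0 x))^-1 * tau (face 1 x))%g.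
Proof.
rewrite [LHS](pgroup_lift_gen (@loop_face_gen_degen0 n _)).
by rewrite /loop_face_gen inordK.
Qed.

Lemma loop_face_tau n i (x : X n.+2) : (0 < i <= n.+1)%N ->
  loop_face (inord i) (tau x) = tau (face i.+1 x).
Proof.
move=> /andP[i0 ile]; rewrite [LHS](pgroup_lift_gen (@loop_face_gen_degen0 n _)).
by rewrite /loop_face_gen inordK // -[i == _]negbK -lt0n i0.
Qed.

Lemma loop_degen_tau n i (x : X n.+1) : (i <= n)%N ->
  loop_degen (inord i) (tau x) = tau (degen i.+1 x).
Proof.
move=> ile; rewrite [LHS](pgroup_lift_gen (@loop_degen_gen_degen0 n _)).
by rewrite inordK.
Qed.

Lemma loop_ind n (P : loop n -> Prop) : P 1%g ->
  (forall x a, P a -> P (tau x * a)%g) ->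
  (forall x a, P a -> P ((tau x)^-1 * a)%g) -> forall a, P a.
Proof. exact: pgroup_ind. Qed.

Lemma loop_eq_tau n (G : groupType) (f g : loop n -> G) :
  {morph f : a b / (a * b)%g} -> {morph g : a b / (a * b)%g} ->
  (forall x, f (tau x) = g (tau x)) -> f =1 g.
Proof.
move=> fM gM fg.
have f1 (h : loop n -> G) : {morph h : a b / (a * b)%g} -> h 1%g = 1%g.
  by move=> hM; apply: (mulgI (h 1%g)); rewrite -hM !mulg1.
have fV (h : loop n -> G) : {morph h : a b / (a * b)%g} ->
    forall a, h (a^-1)%g = (h a)^-1%g.
  by move=> hM a; apply: (mulgI (h a)); rewrite -hM !mulgV f1.
elim/loop_ind => [|x a IH|x a IH]; first by rewrite !f1.
- by rewrite fM gM fg IH.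
- by rewrite fM gM !fV // fg IH.
Qed.

Lemma loop_face_face n i j (a : loop n.+2) : (i < j <= n.+2)%N ->
  loop_face (inord i) (loop_face (inord j) a) =
  loop_face (inord j.-1) (loop_face (inord i) a).
Proof.
move=> /andP[ij jn].
move: a; apply: loop_eq_tau => [a b|a b|x]; rewrite ?loop_faceM //.
case: j ij jn => // j; rewrite ltnS => ij jn /=.
rewrite loop_face_tau //.
case: i ij => [_|i ij].
  rewrite !loop_face0_tau loop_faceM loop_faceV.
  case: j jn => [_|j jn].
    rewrite !loop_face0_tau !invMg !invgK -!mulgA.
    rewrite (face_face (i := 0) (j := 2)) // (face_face (i := 1) (j := 2)) //.
    by rewrite (face_face (i := 0) (j := 1)) //= mulKVg.
  rewrite !loop_face_tau //.
  by rewrite (face_face (i := 0) (j := j.+3)) // (face_face (i := 1) (j := j.+3)).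
rewrite !loop_face_tau ?(face_face (i := i.+2) (j := j.+2)) //.
all: lia.
Qed.

Lemma loop_degen_degen n i j (a : loop n) : (i <= j <= n)%N ->
  loop_degen (inord i) (loop_degen (inord j) a) =
  loop_degen (inord j.+1) (loop_degen (inord i) a).
Proof.
move=> /andP[ij jn].
move: a; apply: loop_eq_tau => [a b|a b|x]; rewrite ?loop_degenM //.
have ile := leq_trans ij jn.
rewrite !loop_degen_tau // ?(degen_degen (i := i.+1) (j := j.+1)) ?ltnS ?ij //.
exact: leqW.
Qed.

Lemma loop_face_degen_lt n i j (a : loop n.+1) : (i < j <= n.+1)%N ->
  loop_face (inord i) (loop_degen (inord j) a) =
  loop_degen (inord j.-1) (loop_face (inord i) a).
Proof.
move=> /andP[ij jn].
move: a; apply: loop_eq_tau => [a b|a b|x];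
  rewrite ?loop_faceM ?loop_degenM ?loop_faceM //.
case: j ij jn => // j; rewrite ltnS => ij jn /=.
rewrite loop_degen_tau //; case: i ij => [_|i ij].
  rewrite !loop_face0_tau loop_degenM loop_degenV !loop_degen_tau //.
  by rewrite (face_degen_lt (i := 0)) // (face_degen_lt (i := 1)).
have ile : (i <= n)%N by rewrite ltnW // (leq_trans ij).
by rewrite !loop_face_tau 1?loop_degen_tau 1?(face_degen_lt (i := i.+2)) //; lia.
Qed.

Lemma loop_face_degen_id n i j (a : loop n) :
  (j <= i <= j.+1)%N -> (j <= n)%N ->
  loop_face (inord i) (loop_degen (inord j) a) = a.
Proof.
move=> /andP[ji ij] jn.
move: a; apply: loop_eq_tau => [a b|//|x];
  rewrite ?loop_degenM ?loop_faceM //.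
rewrite loop_degen_tau //; case: i ji ij => [|i] ji ij.
  move: ji; rewrite leqn0 => /eqP -> {j ij jn}.
  rewrite loop_face0_tau face_degen_lt // (face_degen_id (i := 1)) //=.
  by rewrite tau_degen0 invg1 mul1g.
by rewrite loop_face_tau 1?(face_degen_id (i := i.+2)) //; lia.
Qed.

Lemma loop_face_degen_gt n i j (a : loop n.+1) : (j.+1 < i <= n.+2)%N ->
  loop_face (inord i) (loop_degen (inord j) a) =
  loop_degen (inord j) (loop_face (inord i.-1) a).
Proof.
move=> /andP[ji ile].
move: a; apply: loop_eq_tau => [a b|a b|x];
  rewrite ?loop_faceM ?loop_degenM ?loop_faceM //.
case: i ji ile => // -[//|i]; rewrite !ltnS /= => ji ile.
have jn : (j <= n)%N by apply: leq_trans ji _.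
rewrite loop_degen_tau ?(leqW jn) // loop_face_tau //.
by rewrite loop_face_tau 1?loop_degen_tau 1?(face_degen_gt (i := i.+3)) //; lia.
Qed.

Definition loopS : sset :=
  Sset loop_face_face loop_degen_degen loop_face_degen_lt loop_face_degen_id
       loop_face_degen_gt.

End LoopGroup.

Section ChainExtension.
Variables (X : sset) (n : nat).

Lemma chain_degen (x : X n) : degenerate x -> chain x = 0.
Proof. by move=> dx; rewrite /chain insubF // /nondegenerate asboolT. Qed.

Lemma chain_val (y : nsimplex X n) :
  chain (val y : X n) = << y >>.
Proof. by rewrite /chain valK. Qed.

Lemma chain_case (x : X n) :
  degenerate x /\ chain x = 0 \/
  exists2 y : nsimplex X n, val y = x & chain x = << y >>.
Proof.
rewrite /chain; case: insubP => [y _ yx|]; first by right; exists y.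
by rewrite /nondegenerate negbK => /asboolP; left.
Qed.

Lemma nchain_ind (P : nchain X n -> Prop) :
  P 0 -> (forall a b, P a -> P b -> P (a + b)) -> (forall a, P a -> P (- a)) ->
  (forall x, P (chain x)) -> forall c, P c.
Proof.
move=> P0 PD PN PU; have PMn (m : nat) (a : nchain X n) : P a -> P (a *+ m).
  by move=> Pa; elim: m => [|m IH]; rewrite ?mulr0n // mulrS; apply: PD.
apply: freeg_ind_dom0 => // k y c _ _ Pc; apply: PD => //.
rewrite -[k]intz -freegU_mulz -chain_val; case: k => m.
  exact/PMn/PU.
by rewrite NegzE mulrNz; exact/PN/PMn/PU.
Qed.

Variables (V : zmodType) (f : X n -> V).

Definition chain_ext (c : nchain X n) : V :=
  fglift (fun y : nsimplex X n => f (val y) : zmodule V) c.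

Lemma chain_ext_is_zmod_morphism : zmod_morphism chain_ext.
Proof. exact: (@lift_is_additive _ _ (zmodule V)). Qed.

HB.instance Definition _ :=
  GRing.isZmodMorphism.Build (nchain X n) V chain_ext chain_ext_is_zmod_morphism.

Lemma chain_extE (x : X n) :
  (degenerate x -> f x = 0) -> chain_ext (chain x) = f x.
Proof.
move=> f0; rewrite /chain; case: insubP => [y _ yx|].
  by rewrite /chain_ext liftU -yx; exact: mulr1z.
by rewrite /nondegenerate negbK => /asboolP/f0 ->; rewrite raddf0.
Qed.

End ChainExtension.

Lemma nchain_additive_eq (X : sset) n (V : zmodType)
    (f g : {additive nchain X n -> V}) :
  (forall x, f (chain x) = g (chain x)) -> f =1 g.
Proof.
move=> fg; apply: nchain_ind => // [|a b fga fgb|a fga].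
- by rewrite !raddf0.
- by rewrite !raddfD fga fgb.
- by rewrite !raddfN fga.
Qed.

(* A (p,q)-shuffle (nu, mu) is encoded by the permutation
   s = (nu(1),...,nu(p), mu(1),...,mu(q)) of {0,...,p+q-1}. *)
Section Shuffle.
Variables p q : nat.

Definition shuffle_nu (s : 'S_(p + q)) (i : 'I_p) : nat := s (lshift q i).
Definition shuffle_mu (s : 'S_(p + q)) (j : 'I_q) : nat := s (rshift p j).

Definition is_shuffle (s : 'S_(p + q)) : bool :=
  [forall i : 'I_p, forall j : 'I_p,
      (i < j) ==> (shuffle_nu s i < shuffle_nu s j)]%N &&
  [forall i : 'I_q, forall j : 'I_q,
      (i < j) ==> (shuffle_mu s i < shuffle_mu s j)]%N.

Variable X : sset.

Definition shuffle_term (s : 'S_(p + q)) (g : loop X p) (h : loop X q) :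
    loop X (p + q) :=
  (cast_simplex (addnC q p)
     (iter_degen (X := loopS X) (shuffle_mu s) g : loopS X (q + p)%N)
   * iter_degen (X := loopS X) (shuffle_nu s) h)%g.

Definition shuffle_simplex (g : loop X p) (h : loop X q) :
    nchain (loopS X) (p + q) :=
  \sum_(s | is_shuffle s)
    (-1) ^+ s *: chain (X := loopS X) (shuffle_term s g h).

(* The bilinear extension from the basis of nondegenerate simplices; by
   [shuffle_mul_chain] below, the formula then holds for all simplices. *)
Definition shuffle_mul (a : nchain (loopS X) p) (b : nchain (loopS X) q) :
    nchain (loopS X) (p + q) :=
  fglift (fun g : nsimplex (loopS X) p =>
    fglift (fun h : nsimplex (loopS X) q =>
      shuffle_simplex (val g) (val h)) b) a.

End Shuffle.

Section DegenAt.
Variable X : sset.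

Inductive degen_at (c : nat) : forall n, X n -> Prop :=
  DegenAt n (z : X n) : (c <= n)%N -> degen_at c (degen c z).

Lemma degen_atP c n (x : X n.+1) :
  degen_at c x -> exists2 z : X n, (c <= n)%N & x = degen c z.
Proof.
move=> H.
refine (match H in @degen_at _ n0 x0 return
  match n0 return X n0 -> Prop with
  | 0 => fun _ => True
  | n1.+1 => fun x1 => exists2 z : X n1, (c <= n1)%N & x1 = degen c z
  end x0 with DegenAt m z cm => _ end).
by exists z.
Qed.

Lemma degen_at_degenerate c n (x : X n) : degen_at c x -> degenerate x.
Proof. by case=> n' z _; apply: Degenerate. Qed.

Lemma degen_at_cast c m n (e : m = n) (x : X m) :
  degen_at c x -> degen_at c (cast_simplex e x).
Proof. by case: n / e. Qed.

Lemma degen_at_above c m n (x : X n) :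
  (c < m <= n)%N -> degen_at c x -> degen_at c (degen m x).
Proof.
move=> cm H; case: H cm => n1 z cn; case: m => // m /andP[cm mn].
have cmn : (c <= m <= n1)%N by lia.
by rewrite -degen_degen //; apply: DegenAt; lia.
Qed.

Lemma degen_at_below c m n (x : X n) :
  (m <= c <= n)%N -> degen_at c x -> degen_at c.+1 (degen m x).
Proof.
move=> cm H; case: H cm => n1 z cn /andP[mc _].
have mcn : (m <= c <= n1)%N by rewrite mc.
by rewrite degen_degen //; apply: DegenAt; lia.
Qed.

Definition increasing q (mu : 'I_q -> nat) : Prop :=
  forall i j : 'I_q, (i < j)%N -> (mu i < mu j)%N.

Lemma iter_degen_at_in q n (mu : 'I_q -> nat) (x : X n) (j : 'I_q) :
  increasing mu -> (forall i, mu i <= n + i)%N ->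
  degen_at (mu j) (iter_degen mu x).
Proof.
elim: q mu j => [|q IH] mu j muI mub /=; first by case: j.
have mx : (mu ord_max <= q + n)%N by rewrite addnC; exact: mub.
case: (ltnP j q) => jq; last first.
  have -> : j = ord_max by apply: val_inj; have /= := ltn_ord j; lia.
  exact: DegenAt.
apply: degen_at_above; first by rewrite mx andbT; apply: muI.
have -> : j = widen_ord (leqnSn q) (Ordinal jq) by exact: val_inj.
by apply: (IH (fun i => mu (widen_ord _ i))) => // i i' ii'; apply: muI.
Qed.

Lemma iter_degen_at_notin q n (mu : 'I_q -> nat) (x : X n) k c :
  increasing mu -> (forall i, mu i <= n + i)%N -> degen_at k x ->
  (forall i, mu i != c) -> (k + \sum_(i < q) (mu i < c) = c)%N ->
  degen_at c (iter_degen mu x).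
Proof.
elim: q mu c => [|q IH] mu c muI mub dx muc.
  by rewrite big_ord0 addn0 => <-.
have mx : (mu ord_max <= q + n)%N by rewrite addnC; exact: mub.
have muI' : increasing (fun i => mu (widen_ord (leqnSn q) i)).
  by move=> i j ij; apply: muI.
have kn : (k < n)%N by case: dx => n' z.
rewrite big_ord_recr /=; case: (ltngtP (mu ord_max) c) => mc; last first.
- by have := muc ord_max; rewrite mc eqxx.
- rewrite addn0 => ec; apply: degen_at_above; first by rewrite mc.
  exact: IH.
have all1 : forall i : 'I_q, (mu (widen_ord (leqnSn q) i) < mu ord_max)%N.
  by move=> i; apply: muI; exact: (ltn_ord i).
rewrite (eq_bigr (fun=> 1)) => [|i _]; last by rewrite (ltn_trans (all1 i)).
rewrite sum1_card card_ord addnA addn1; case: c muc mc => // c muc mc [ec].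
have b : (mu ord_max <= c <= q + n)%N by lia.
apply: (degen_at_below b); apply: IH muI' _ dx _ _ => [i|i|]; first exact: mub.
  by apply/eqP => mic; have := all1 i; rewrite mic; lia.
rewrite (eq_bigr (fun=> 1)) ?sum1_card ?card_ord // => i _.
by have := all1 i; case: ltnP => //; lia.
Qed.

End DegenAt.

Lemma degen_atM (X : sset) n c (g h : loop X n) :
  degen_at (X := loopS X) c g -> degen_at (X := loopS X) c h ->
  degen_at (X := loopS X) c (g * h)%g.
Proof.
move=> dg; case: dg h => n1 z cn h /degen_atP[y _ ->].
have -> : (degen (X := loopS X) c z * degen (X := loopS X) c y)%g =
  degen (X := loopS X) c ((z : loop X n1) * (y : loop X n1))%g.
  by rewrite [RHS]loop_degenM.
exact: DegenAt.
Qed.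

Section ShuffleDegenerate.
Variables p q : nat.
Implicit Type s : 'S_(p + q).

Lemma sum_ord_ltn N c : (c <= N)%N -> (\sum_(i < N) (i < c) = c)%N.
Proof.
move=> cN; transitivity (\sum_(i < c) 1)%N; last by rewrite sum1_card card_ord.
rewrite (big_ord_widen N (fun=> 1) cN) [RHS]big_mkcond.
by apply: eq_bigr => i _; case: ifP.
Qed.

Lemma shuffle_count s (c : nat) : (c <= p + q)%N ->
  (\sum_(i < p) (shuffle_nu s i < c) + \sum_(j < q) (shuffle_mu s j < c) = c)%N.
Proof.
move=> cpq.
rewrite -[RHS](sum_ord_ltn cpq) [RHS](reindex_inj (@perm_inj _ s)).
by rewrite [RHS]big_split_ord.
Qed.

Lemma increasing_count r (mu : 'I_r -> nat) (j : 'I_r) :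
  increasing mu -> (\sum_(i < r) (mu i < mu j) = j)%N.
Proof.
move=> muI; transitivity (\sum_(i < r) (i < j))%N.
  2: exact: sum_ord_ltn (ltnW (ltn_ord j)).
apply: eq_bigr => i _; congr (nat_of_bool _); case: (ltngtP i j) => ij.
- exact: muI.
- by apply/negbTE; rewrite -leqNgt ltnW // muI.
- by rewrite (val_inj ij) ltnn.
Qed.

Lemma sum_bool_le r (P : pred 'I_r) : (\sum_(i < r) P i <= r)%N.
Proof.
apply: (@leq_trans (\sum_(i < r) 1)); last by rewrite sum1_card card_ord.
by apply: leq_sum => i _; exact: leq_b1.
Qed.

Lemma is_shuffleP s : is_shuffle s ->
  increasing (shuffle_nu s) /\ increasing (shuffle_mu s).
Proof.
by case/andP=> /forallP nuI /forallP muI; split=> i j ij;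
  [have /forallP/(_ j)/implyP := nuI i | have /forallP/(_ j)/implyP := muI i]; apply.
Qed.

Lemma shuffle_nu_count s (i : 'I_p) : is_shuffle s ->
  (i + \sum_(j < q) (shuffle_mu s j < shuffle_nu s i) = shuffle_nu s i)%N.
Proof.
case/is_shuffleP=> nuI _; rewrite -{2}(@shuffle_count s (shuffle_nu s i)) ?increasing_count //.
exact/ltnW/ltn_ord.
Qed.

Lemma shuffle_mu_count s (j : 'I_q) : is_shuffle s ->
  (j + \sum_(i < p) (shuffle_nu s i < shuffle_mu s j) = shuffle_mu s j)%N.
Proof.
case/is_shuffleP=> _ muI; rewrite -{2}(@shuffle_count s (shuffle_mu s j)) ?increasing_count //.
  by rewrite addnC.
exact/ltnW/ltn_ord.
Qed.

Lemma shuffle_nu_le s (i : 'I_p) : is_shuffle s -> (shuffle_nu s i <= q + i)%N.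
Proof.
by move=> sh; rewrite -(shuffle_nu_count i sh) addnC leq_add2r sum_bool_le.
Qed.

Lemma shuffle_mu_le s (j : 'I_q) : is_shuffle s -> (shuffle_mu s j <= p + j)%N.
Proof.
by move=> sh; rewrite -(shuffle_mu_count j sh) addnC leq_add2r sum_bool_le.
Qed.

Lemma shuffle_mu_nu s i j : shuffle_mu s j != shuffle_nu s i.
Proof.
rewrite /shuffle_mu /shuffle_nu (inj_eq val_inj) (inj_eq perm_inj).
by rewrite eq_rlshift.
Qed.

Variable X : sset.

Lemma degenerate_at (Y : sset) n (x : Y n) :
  degenerate x -> exists2 k : 'I_n, (k < n)%N & degen_at k x.
Proof.
case=> {x}m i x; exists i => //; rewrite -[i in degen_map i]inord_val.
by apply: DegenAt; rewrite -ltnS.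
Qed.

Lemma shuffle_term_degen s (g : loop X p) (h : loop X q) : is_shuffle s ->
  degenerate (X := loopS X) g \/ degenerate (X := loopS X) h ->
  degenerate (X := loopS X) (shuffle_term s g h).
Proof.
move=> sh; have [nuI muI] := is_shuffleP sh.
case=> /degenerate_at[k _ dk].
- apply: (@degen_at_degenerate _ (shuffle_nu s k)); apply: degen_atM.
  + apply: degen_at_cast; apply: (iter_degen_at_notin (k := k)) => //.
    * by move=> j; apply: shuffle_mu_le.
    * by move=> j; apply: shuffle_mu_nu.
    * exact: shuffle_nu_count.
  + by apply: iter_degen_at_in => // i; apply: shuffle_nu_le.
- apply: (@degen_at_degenerate _ (shuffle_mu s k)); apply: degen_atM.
  + apply: degen_at_cast.
    by apply: iter_degen_at_in => // i; apply: shuffle_mu_le.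
  + apply: (iter_degen_at_notin (k := k)) => //.
    * by move=> j; apply: shuffle_nu_le.
    * by move=> j; rewrite eq_sym; apply: shuffle_mu_nu.
    * exact: shuffle_mu_count.
Qed.

Lemma shuffle_mul_chain (g : loop X p) (h : loop X q) :
  shuffle_mul (chain (X := loopS X) g) (chain (X := loopS X) h) =
  shuffle_simplex g h.
Proof.
have sd (g' : loop X p) (h' : loop X q) :
    degenerate (X := loopS X) g' \/ degenerate (X := loopS X) h' ->
    shuffle_simplex g' h' = 0.
  move=> dgh; apply: big1 => s sh.
  by rewrite chain_degen ?scaler0 //; apply: shuffle_term_degen.
have lift0 (K : choiceType) (F : K -> nchain (loopS X) (p + q)) : fglift F 0 = 0.
  by rewrite -(subrr 0) lift_is_additive subrr.
rewrite /shuffle_mul.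
have [[dg ->]|[g' <- ->]] := chain_case (X := loopS X) g.
  by rewrite [LHS]lift0 sd //; left.
rewrite [LHS]liftU scale1r.
have [[dh ->]|[h' <- ->]] := chain_case (X := loopS X) h.
  by rewrite [LHS]lift0 sd //; right.
by rewrite [LHS]liftU scale1r.
Qed.

End ShuffleDegenerate.

Section Retraction.
Variable X : sset.

Local Notation lchain := (chain (X := loopS X)).
Local Notation face0 := (iter_face0 (X := loopS X)).

Definition retraction_spec
    (f : forall n, {additive nchain (loopS X) n -> cobar X}) : Prop :=
  [/\ forall n c, cobar_deg n (f n c),
      f 0%N (lchain (1%g : loop X 0)) = 1 &
      forall n (x : X n.+1) (g : loop X n),
        f n (lchain (tau x * g)%g) =
        f n (lchain g) -
        \sum_(i < n.+1) desusp (front i x) *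
          f (n - i)%N (lchain (tau (iter_face1 i x) * face0 i g)%g)].

Definition edge n (x : X n.+1) : X 1%N :=
  cast_simplex (congr1 succn (subKn (leq0n n))) (front 0 x).

Lemma desusp_cast m n (e : m = n) (x : X m.+1) :
  desusp (cast_simplex (congr1 succn e) x) = desusp x.
Proof. by case: n / e. Qed.

Lemma desusp_edge n (x : X n.+1) : desusp (edge x) = desusp (front 0 x).
Proof. exact: desusp_cast. Qed.

Lemma iter_face_last_degen k m j (x : X m) : (j <= m - k)%N ->
  degenerate (iter_face_last k (degen j x)).
Proof.
elim: k m j x => [|k IH] [|m] j x jm; try exact: Degenerate.
by rewrite /= face_degen_gt; [apply: IH | lia].
Qed.

Lemma degenerate_cast m n (e : m = n) (x : X m) :
  degenerate x -> degenerate (cast_simplex e x).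
Proof. by case: n / e. Qed.

Lemma front_degen n i j (x : X n) : (i <= n)%N -> (j <= i)%N ->
  degenerate (front i (degen j x)).
Proof. by move=> ile ji; apply: iter_face_last_degen; rewrite subKn. Qed.

Section Step.
Variable F : forall m, loop X m -> cobar X.

(* the terms i >= 1 of the recursion; solving it for the term i = 0, which is
   multiplied by 1 + s^-1 x_(0,1), brings in xi *)
Definition psi_tail n (x : X n.+1) (g : loop X n) : cobar X :=
  \sum_(i < n) desusp (front i.+1 x) *
    F (tau (iter_face1 i.+1 x) * face0 i.+1 g)%g.

Lemma psi_tail_degen0 n (y : X n) g : psi_tail (degen 0 y) g = 0.
Proof.
apply: big1 => i _; rewrite desusp_degen ?mul0r //.
exact: front_degen.
Qed.

Fixpoint psi_word n (u : gword (X n.+1)) : cobar X :=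
  match u with
  | [::] => (n == 0)%:R
  | (x, true) :: v => (1 + desusp (edge x)) * psi_word v
      + psi_tail x ((tau x)^-1 * \pi_(loop X n) (v : gword (X n.+1)))%g
  | (x, false) :: v =>
      xi (edge x) * (psi_word v - psi_tail x (\pi_(loop X n) (v : gword (X n.+1))))
  end.

Lemma psi_word_cat_eq n (w u v : gword (X n.+1)) :
  \pi_(loop X n) u = \pi_(loop X n) v -> psi_word u = psi_word v ->
  psi_word (w ++ u) = psi_word (w ++ v).
Proof.
move=> puv wuv; elim: w => [|[x b] w /= ->] //.
have -> // : \pi_(loop X n) (w ++ u : gword _) = \pi_(loop X n) (w ++ v : gword _).
by rewrite -!pgroup_mul_pi puv.
Qed.

Lemma psi_word_eq n (u v : gword (X n.+1)) :
  gword_eq (fun x : X n.+1 => exists y : X n, x = degen 0 y) u v ->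
  psi_word u = psi_word v.
Proof.
elim=> {u v} [u|u w _|u w z _ -> _ ->|u v x b|u v x b Kx] //.
- apply: psi_word_cat_eq.
    by apply/eqP/pgroup_eqP; have := GwCancel _ [::] v x b.
  case: b => /=.
    rewrite [\pi_(loop X n) ((x, false) :: v)](pi_cons _ x false v) mulKg.
    by rewrite mulrA Mxi mul1r subrK.
  rewrite [\pi_(loop X n) ((x, true) :: v)](pi_cons _ x true v).
  by rewrite addrK mulrA xiM mul1r.
- apply: psi_word_cat_eq.
    by apply/eqP/pgroup_eqP; apply: (GwKill [::]).
  case: Kx => y ->; have e0 : desusp (edge (degen 0 y)) = 0.
    by rewrite desusp_edge desusp_degen //; exact: front_degen.
  have x1 : xi (edge (degen 0 y)) = 1.
    by have := xiM (edge (degen 0 y)); rewrite e0 addr0 mulr1.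
  by case: b => /=; rewrite !psi_tail_degen0 ?e0 ?x1 ?addr0 ?subr0 mul1r.
Qed.

Definition psi_step n (g : loop X n) : cobar X := psi_word (repr g).

Lemma psi_step_pi n (u : gword (X n.+1)) :
  psi_step (\pi_(loop X n) u) = psi_word u.
Proof. exact/psi_word_eq/repr_gword_eq. Qed.

Lemma psi_step1 n : psi_step (1%g : loop X n) = (n == 0)%:R.
Proof. exact: (psi_step_pi [::]). Qed.

Lemma psi_stepM n (x : X n.+1) (g : loop X n) :
  psi_step (tau x * g)%g = xi (edge x) * (psi_step g - psi_tail x g).
Proof.
elim/quotW: g => u; rewrite -[(tau x * _)%g](pi_cons _ x false) .
by rewrite !psi_step_pi.
Qed.

End Step.

Lemma eq_psi_tail (F F' : forall m, loop X m -> cobar X) n :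
  (forall m, (m < n)%N -> @F m =1 @F' m) ->
  forall (x : X n.+1) g, psi_tail F x g = psi_tail F' x g.
Proof.
by move=> FF' x g; apply: eq_bigr => i _; rewrite FF' //; case: i => i /=; lia.
Qed.

Lemma eq_psi_step (F F' : forall m, loop X m -> cobar X) n :
  (forall m, (m < n)%N -> @F m =1 @F' m) ->
  @psi_step F n =1 @psi_step F' n.
Proof.
move=> FF' g; rewrite /psi_step; elim: (repr g) => [|[x b] u IH] //=.
by rewrite IH !(eq_psi_tail FF').
Qed.

Fixpoint psi_fuel (k : nat) : forall n, loop X n -> cobar X :=
  if k is k'.+1 then psi_step (psi_fuel k') else fun _ _ => 0.

Lemma eq_psi_fuel k k' n : (n < k)%N -> (n < k')%N ->
  @psi_fuel k n =1 @psi_fuel k' n.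
Proof.
elim: k k' n => [|k IH] [|k'] n // nk nk'; apply: eq_psi_step => m mn.
by apply: IH; lia.
Qed.

Definition psi_simplex n (g : loop X n) : cobar X := psi_fuel n.+1 g.

Lemma psi_simplexE n : @psi_simplex n =1 @psi_step psi_simplex n.
Proof. by apply: eq_psi_step => m mn; apply: eq_psi_fuel; lia. Qed.

Lemma psi_simplex1 n : psi_simplex (1%g : loop X n) = (n == 0)%:R.
Proof. by rewrite psi_simplexE psi_step1. Qed.

Lemma psi_simplexM n (x : X n.+1) (g : loop X n) :
  psi_simplex (tau x * g)%g =
  xi (edge x) * (psi_simplex g - psi_tail psi_simplex x g).
Proof. by rewrite !psi_simplexE psi_stepM. Qed.

Lemma psi_tailE (F : forall m, loop X m -> cobar X) n (x : X n.+1) g :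
  \sum_(i < n.+1) desusp (front i x) *
     F (n - i)%N (tau (iter_face1 i x) * face0 i g)%g =
  desusp (edge x) * F n (tau x * g)%g + psi_tail F x g.
Proof.
rewrite big_ord_recl desusp_edge; congr (_ * _ + _).
by case: n x g.
Qed.

Lemma psi_simplex_spec n (x : X n.+1) (g : loop X n) :
  psi_simplex (tau x * g)%g = psi_simplex g -
    \sum_(i < n.+1) desusp (front i x) *
      psi_simplex (tau (iter_face1 i x) * face0 i g)%g.
Proof.
rewrite (psi_tailE psi_simplex) opprD addrCA addrC -[LHS](addrK (desusp (edge x) * psi_simplex (tau x * g)%g)).
congr (_ - _); rewrite -[X in X + _]mul1r -mulrDl psi_simplexM.
by rewrite mulrA Mxi mul1r.
Qed.

Lemma iter_face_tau_degen i n j (x : X n.+1) (g : loop X n) :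
  (i <= j <= n)%N ->
  degenerate (X := loopS X)
    (tau (iter_face1 i (degen j.+1 x)) *
     face0 i (degen (X := loopS X) j g))%g.
Proof.
elim: i n j x g => [|i IH] n j x g /andP[ij jn].
  have -> : (tau (degen j.+1 x) * degen (X := loopS X) j g)%g =
            degen_map (s := loopS X) (inord j) (tau x * g)%g.
    by rewrite [RHS]loop_degenM loop_degen_tau.
  exact: (Degenerate (X := loopS X)).
case: j ij jn => // j ij; case: n x g => // n x g jn.
rewrite /= (face_degen_lt (X := X)) /=; last by lia.
rewrite (face_degen_lt (X := loopS X)) /=; last by lia.
by apply: IH; lia.
Qed.

Lemma psi_simplex_degen n (g : loop X n) :
  degenerate (X := loopS X) g -> psi_simplex g = 0.
Proof.
elim/ltn_ind: n g => n IH g dg.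
case: dg IH => {n g} n j g IH; rewrite -(inord_val j) in IH *.
have /= jn := ltn_ord j; move: (nat_of_ord j) jn => {}j jn.
have tail0 (x : X n.+1) (h : loop X n) :
    psi_tail psi_simplex (degen j.+1 x) (degen (X := loopS X) j h) = 0.
  apply: big1 => i _; have ile := ltn_ord i.
  case: (leqP i.+1 j) => ij.
    rewrite IH ?mulr0 //; first by lia.
    by apply: (iter_face_tau_degen (i := i.+1)); lia.
  by rewrite desusp_degen ?mul0r //; apply: front_degen; lia.
move: g; rewrite /=; elim/loop_ind => [|x g IHg|x g IHg].
- by rewrite loop_degen1 psi_simplex1.
- rewrite loop_degenM loop_degen_tau // psi_simplexM IHg.
  by rewrite [psi_tail _ _ _](tail0 x g) subr0 mulr0.
- move: IHg; rewrite -{1}(mulKVg (tau x) g); set h := (_ * g)%g.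
  rewrite loop_degenM loop_degen_tau // psi_simplexM.
  rewrite [psi_tail _ _ _](tail0 x h) subr0 => /(congr1 ( *%R (1 + desusp (edge (degen j.+1 x))))).
  by rewrite mulrA Mxi mul1r mulr0.
Qed.

Lemma cobar_deg_sum n (I : Type) (r : seq I) (P : pred I) (F : I -> cobar X) :
  (forall i, P i -> cobar_deg n (F i)) -> cobar_deg n (\sum_(i <- r | P i) F i).
Proof. by apply: big_ind; [exact: CdZero | exact: CdAdd]. Qed.

Lemma psi_tail_deg (F : forall m, loop X m -> cobar X) n (x : X n.+1) g :
  (forall m, (m < n)%N -> forall h, cobar_deg m (F m h)) ->
  cobar_deg n (psi_tail F x g).
Proof.
move=> dF; apply: cobar_deg_sum => i _; have ile := ltn_ord i.
have e : (n - (n - i.+1) + (n - i.+1) = n)%N by lia.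
rewrite -[X in cobar_deg X _]e; apply: CdMul; first exact: CdDesusp.
by apply: dF; lia.
Qed.

Lemma psi_simplex_deg n (g : loop X n) : cobar_deg n (psi_simplex g).
Proof.
elim/ltn_ind: n g => n IH; elim/loop_ind => [|x g IHg|x g IHg].
- by rewrite psi_simplex1; case: n {IH} => [|n]; [exact: CdOne|exact: CdZero].
- rewrite psi_simplexM -[X in cobar_deg X _]add0n; apply: CdMul; first exact: CdXi.
  by apply: CdAdd => //; apply/CdOpp/psi_tail_deg.
- move: IHg; rewrite -{1}(mulKVg (tau x) g); set h := (_ * g)%g.
  rewrite psi_simplexM => dg.
  suff -> : psi_simplex h = (1 + desusp (edge x)) *
     (xi (edge x) * (psi_simplex h - psi_tail psi_simplex x h))
     + psi_tail psi_simplex x h.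
    apply: CdAdd; last exact: psi_tail_deg.
    rewrite -[X in cobar_deg X _]add0n; apply: CdMul => //.
    by apply: CdAdd; [exact: CdOne | exact: CdDesusp].
  by rewrite mulrA Mxi mul1r subrK.
Qed.

End Retraction.

Theorem psi_exists (X : sset) :
  exists f : forall n, {additive nchain (loopS X) n -> cobar X},
    retraction_spec f.
Proof.
have E n (g : loop X n) : chain_ext (@psi_simplex X n : loopS X n -> _)
    (chain (X := loopS X) g) = psi_simplex g.
  exact/chain_extE/psi_simplex_degen.
exists (fun n => chain_ext (@psi_simplex X n : loopS X n -> _)); split.
- move=> n; apply: nchain_ind => [|a b da db|a da|g].
  + by rewrite raddf0; exact: CdZero.
  + by rewrite raddfD; exact: CdAdd.
  + by rewrite raddfN; exact: CdOpp.
  + by rewrite [X in cobar_deg _ X]E; exact: psi_simplex_deg.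
- by rewrite [LHS]E psi_simplex1.
- move=> n x g; rewrite [LHS]E [X in X - _]E psi_simplex_spec.
  by congr (_ - _); apply: eq_bigr => i _; rewrite [X in _ = _ * X]E.
Qed.

Theorem psi_unique (X : sset)
    (f f' : forall n, {additive nchain (loopS X) n -> cobar X}) :
  retraction_spec f -> retraction_spec f' -> forall n, f n =1 f' n.
Proof.
move=> [_ f1 fM] [_ f1' fM'] n; apply: nchain_additive_eq; elim/ltn_ind: n.
move=> n IH.
have tailE (x : X n.+1) (g : loop X n) :
    psi_tail (fun m h => f m (chain (X := loopS X) h)) x g =
    psi_tail (fun m h => f' m (chain (X := loopS X) h)) x g.
  by apply: eq_psi_tail => m mn h; apply: IH.
have key (x : X n.+1) (g : loop X n) :
    f n (chain (X := loopS X) (tau x * g)%g) =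
      f' n (chain (X := loopS X) (tau x * g)%g) <->
    f n (chain (X := loopS X) g) = f' n (chain (X := loopS X) g).
  have := fM n x g; have := fM' n x g.
  rewrite (psi_tailE (fun m h => f m (chain (X := loopS X) h))).
  rewrite (psi_tailE (fun m h => f' m (chain (X := loopS X) h))) tailE.
  set a := f _ _; set a' := f' _ _; set b := f _ _; set b' := f' _ _.
  set t := psi_tail _ _ _; set d := desusp _ => e' e; split=> [aa|bb].
    by move: e e'; rewrite aa => e e'; apply: addIr (etrans (esym e) e').
  have me (u v : cobar X) : u = v - (d * u + t) -> u = xi (edge x) * (v - t).
    move=> uv; rewrite -[LHS]mul1r -(xiM (edge x)) -mulrA; congr (_ * _).
    by rewrite mulrDl mul1r {1}uv opprD addrA addrAC subrK.
  by rewrite (me _ _ e) (me _ _ e') bb.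
elim/loop_ind => [|x g IHg|x g IHg].
- case: n {IH tailE key} => [|n]; first by rewrite f1 f1'.
  rewrite (_ : chain _ = 0) ?raddf0 //; apply: chain_degen.
  have <- : loop_degen (0 : 'I_n.+1) (1%g : loop X n) = 1%g by exact: loop_degen1.
  exact: (Degenerate (X := loopS X)).
- exact/key.
- by apply/(key x); rewrite mulKVg.
Qed.

Definition psi (X : sset) :
    forall n, {additive nchain (loopS X) n -> cobar X} :=
  sval (cid (psi_exists X)).

Lemma psiP (X : sset) : retraction_spec (psi X).
Proof. exact: svalP (cid (psi_exists X)). Qed.

Definition graded_algebra_hom (X : sset)
    (f : forall n, {additive nchain (loopS X) n -> cobar X}) : Prop :=
  [/\ forall n c, cobar_deg n (f n c),
      f 0%N (chain (X := loopS X) (1%g : loop X 0)) = 1 &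
      forall p q a b, f (p + q)%N (@shuffle_mul p q X a b) = f p a * f q b].

(* Main.v *)
From HB Require Import structures.
Require Import Defs.
From mathcomp Require Import all_boot all_algebra all_fingroup.
From mathcomp Require Import zify.

Set Implicit Arguments.
Unset Strict Implicit.
Unset Printing Implicit Defensive.

Import GRing.Theory.

Local Open Scope ring_scope.

(* Fix h and let M g be the sum over shuffles of +- psi (s_mu g * s_nu h).
   As s_mu (tau x) = tau y with y = s_(mu + 1) x, the recursion for psi expands
   M (tau x * g).  The front face y_(0,...,i+1) is degenerate unless
   0, ..., i-1 are all in nu; then it is x_(0,...,i+1), and deleting these i
   entries leaves a (p - i, q)-shuffle of the same sign.  Hence
   D g = M g - psi g * psi h satisfies
     D (tau x * g) = D g - sum_i s^-1 x_(0,...,i+1) * D (tau d_1^i x * d_0^i g).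
   By induction on p only the term i = 0 is left, so
   (1 + s^-1 x_(0,1)) * D (tau x * g) = D g with an invertible factor, and D
   vanishes on all words because it vanishes on the empty one. *)

(** * Faces and front faces of iterated degeneracies *)

Section Cast.
Variable Y : sset.

Lemma cast_simplex_id n (e : n = n) (x : Y n) : cast_simplex e x = x.
Proof. by rewrite (eq_irrelevance e erefl). Qed.

Lemma cast_degen m n (e : m = n) (e' : m.+1 = n.+1) c (x : Y m) :
  cast_simplex e' (degen c x) = degen c (cast_simplex e x).
Proof. by case: n / e e' => e'; rewrite !cast_simplex_id. Qed.

Lemma cast_simplex_trans m n k (e : m = n) (e' : n = k) (x : Y m) :
  cast_simplex e' (cast_simplex e x) = cast_simplex (etrans e e') x.
Proof. by case: k / e'. Qed.

(** All indices in [mu] exceed [a], so the face passes every degeneracy and lowers its index by one.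
    The casts are there because [k + n.+1] does not reduce to a successor. *)
Lemma face_iter_degen_gt a k n N (mu mu' : 'I_k -> nat) (x : Y n.+1)
    (e : (k + n.+1 = N.+1)%N) (e' : (k + n = N)%N) :
  (forall j, mu j = (mu' j).+1) -> (forall j, a <= mu' j <= n + j)%N ->
  face a (cast_simplex e (iter_degen mu x)) =
  cast_simplex e' (iter_degen mu' (face a x)).
Proof.
move: e; case: N / e' => e muE mub.
elim: k mu mu' e muE mub => [|k IH] mu mu' e muE mub.
  by rewrite !cast_simplex_id.
have e1 : (k + n.+1 = (k + n).+1)%N by rewrite addnS.
have mb : (a < (mu' ord_max).+1 <= (k + n).+1)%N.
  by have := mub ord_max; rewrite /=; lia.
rewrite /= (cast_degen e1) muE face_degen_lt //.
rewrite (IH _ (fun i => mu' (widen_ord (leqnSn k) i))).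
- by rewrite cast_simplex_id.
- by move=> j; exact: muE.
- by move=> j; exact: (mub (widen_ord _ j)).
Qed.

(** The face passes the outer degeneracies, whose indices are positive, and cancels the innermost
    one, which is [s_0]. *)
Lemma face0_iter_degen k n (nu : 'I_k.+1 -> nat) (nu' : 'I_k -> nat) (x : Y n) :
  nu ord0 = 0%N -> (forall j, nu (lift ord0 j) = (nu' j).+1) ->
  (forall j, nu' j <= n + j)%N ->
  face 0 (iter_degen nu x) = iter_degen nu' x.
Proof.
elim: k nu nu' => [|k IH] nu nu' nu0 nuE nub.
  rewrite /= (_ : ord_max = ord0) ?nu0; last exact: val_inj.
  by rewrite face_degen_id.
have maxE : ord_max = lift ord0 (ord_max : 'I_k.+1) by exact: val_inj.
have nb := nub ord_max.
have mb : (0 < nu ord_max <= (k + n).+1)%N.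
  by rewrite maxE nuE; move: nb => /=; lia.
rewrite [iter_degen nu x]/= face_degen_lt //.
rewrite [in LHS]maxE nuE /=; congr degen.
apply: (IH (fun i => nu (widen_ord _ i))
  (fun i => nu' (widen_ord _ i))) => [|j|j].
- by rewrite -nu0; congr nu; apply: val_inj.
- by rewrite -nuE; congr nu; apply: val_inj.
- exact: (nub (widen_ord _ j)).
Qed.

(** [degen c] puts a second copy of vertex [c] at position [c + 1], which is among the [k + 1]
    deleted positions. *)
Lemma iter_face_last_degen_top k m c (x : Y m.+1) :
  (k <= m)%N -> (m < c + k <= m.+1 + k)%N ->
  iter_face_last k.+1 (degen c x) = iter_face_last k x.
Proof.
elim: k m c x => [|k IH] m c x km cm.
  have -> : c = m.+1 by lia.
  by case: m x {km cm} => [|m] x; rewrite /= face_degen_id //; lia.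
case: m x km cm => // m x km cm.
have [->|cm1] := eqVneq c m.+2.
  by rewrite [LHS]/= face_degen_id //; lia.
rewrite [LHS]/= face_degen_gt; last by lia.
by rewrite [RHS]/= -[RHS](IH _ c (face m.+2 x)) //; lia.
Qed.

End Cast.

(** * Shuffles whose [nu] starts with 0 *)

Lemma lift_perm0_surj n (s : 'S_n.+1) :
  s ord0 = ord0 -> exists t, s = lift_perm ord0 ord0 t.
Proof.
move=> s0; have sl k : {j | s (lift ord0 k) = lift ord0 j}.
  have := neq_lift ord0 k; rewrite -(inj_eq (@perm_inj _ s)) s0.
  by case/unlift_some=> j -> _; exists j.
have inj_t : injective (fun k => sval (sl k)).
  move=> k k' /= e; apply: (@lift_inj _ ord0); apply: (@perm_inj _ s).
  by apply: etrans (svalP (sl k)) _; rewrite e; exact/esym/(svalP (sl k')).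
exists (perm inj_t); apply/permP => k.
case: (unliftP ord0 k) => [j|] ->; last by rewrite lift_perm_id.
by rewrite lift_perm_lift permE; exact: (svalP (sl j)).
Qed.

Lemma is_shuffleE p q (s : 'S_(p + q)) :
  increasing (shuffle_nu s) -> increasing (shuffle_mu s) -> is_shuffle s.
Proof.
move=> nuI muI; apply/andP; split;
  by apply/forallP => i; apply/forallP => j; apply/implyP => ij; auto.
Qed.

Section Shuffles.
Variables p q : nat.

(** Adds 0 as the first entry of [nu] and raises all other entries by one; the sign is unchanged. *)
Definition lift_shuffle (s : 'S_(p + q)) : 'S_(p.+1 + q) := lift_perm ord0 ord0 s.

Lemma shuffle_nu_lift0 (s : 'S_(p + q)) : shuffle_nu (lift_shuffle s) ord0 = 0%N.
Proof.
rewrite /shuffle_nu (_ : lshift q ord0 = ord0); last exact: val_inj.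
by rewrite lift_perm_id.
Qed.

Lemma shuffle_nu_lift (s : 'S_(p + q)) (j : 'I_p) :
  shuffle_nu (lift_shuffle s) (lift ord0 j) = (shuffle_nu s j).+1.
Proof.
have -> : shuffle_nu (lift_shuffle s) (lift ord0 j) =
    lift_perm ord0 ord0 s (lift ord0 (lshift q j)).
  by congr (val (fun_of_perm _ _)); apply: val_inj.
by rewrite lift_perm_lift.
Qed.

Lemma shuffle_mu_lift (s : 'S_(p + q)) j :
  shuffle_mu (lift_shuffle s) j = (shuffle_mu s j).+1.
Proof.
have -> : shuffle_mu (lift_shuffle s) j =
    lift_perm ord0 ord0 s (lift ord0 (rshift p j)).
  by congr (val (fun_of_perm _ _)); apply: val_inj.
by rewrite lift_perm_lift.
Qed.

Lemma is_shuffle_lift (s : 'S_(p + q)) :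
  is_shuffle (lift_shuffle s) = is_shuffle s.
Proof.
apply/idP/idP => /is_shuffleP[nuI muI]; apply: is_shuffleE => i j ij.
- by rewrite -ltnS -!shuffle_nu_lift; apply: nuI; rewrite !lift0.
- by rewrite -ltnS -!shuffle_mu_lift; apply: muI.
- case: (unliftP ord0 i) ij => [i'|] -> ; case: (unliftP ord0 j) => [j'|] -> //;
    rewrite ?shuffle_nu_lift0 ?shuffle_nu_lift // !lift0 !ltnS; exact: nuI.
- by rewrite !shuffle_mu_lift ltnS; apply: muI.
Qed.

(** The value 0 is not taken in the [mu] block; as [nu] increases, it is taken at the first position
    of the [nu] block, so [s] fixes 0. *)
Lemma shuffle_lift_surj (s : 'S_(p.+1 + q)) : is_shuffle s ->
  (forall j, 0 < shuffle_mu s j)%N -> exists t, s = lift_shuffle t.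
Proof.
move=> sh mu0; apply: lift_perm0_surj; apply: val_inj => /=.
have := shuffle_nu_count ord0 sh.
have [nuI _] := is_shuffleP sh.
pose k := (s^-1)%g ord0; have sk : s k = ord0 by rewrite permKV.
case: (split_ordP k) => j kj; last first.
  by have := mu0 j; rewrite /shuffle_mu -kj sk.
have nuj : shuffle_nu s j = 0%N by rewrite /shuffle_nu -kj sk.
case: (unliftP ord0 j) kj nuj => [j'|] -> kj nuj _.
  by have := nuI ord0 (lift ord0 j'); rewrite nuj; move/(_ isT).
by rewrite (_ : ord0 = lshift q ord0) ?[LHS]nuj //; exact: val_inj.
Qed.

End Shuffles.

(** * Products, faces and front faces of shuffle terms *)

Lemma iter_degen_mul (X : sset) k n (mu : 'I_k -> nat) (g h : loop X n) :
  iter_degen (X := loopS X) mu (g * h)%g =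
  (iter_degen (X := loopS X) mu g * iter_degen (X := loopS X) mu h :> loop X _)%g.
Proof. by elim: k mu => [|k IH] mu //=; rewrite IH; exact: loop_degenM. Qed.

Lemma iter_degen_one (X : sset) k n (mu : 'I_k -> nat) :
  iter_degen (X := loopS X) mu (1%g : loop X n) = (1%g : loop X (k + n)).
Proof. by elim: k mu => [|k IH] mu //=; rewrite IH; exact: loop_degen1. Qed.

(** Each step is [s_i (tau x) = tau (s_(i+1) x)]. The bound keeps the indices in range, as [inord]
    sends larger ones to 0. *)
Lemma iter_degen_tau (X : sset) k n N (mu : 'I_k -> nat) (x : X n.+1)
    (e : (k + n = N)%N) (e' : (k + n.+1 = N.+1)%N) :
  (forall j, mu j <= n + j)%N ->
  cast_simplex e (iter_degen (X := loopS X) mu (tau x)) =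
  tau (cast_simplex e' (iter_degen (fun j => (mu j).+1) x)).
Proof.
move: e'; case: N / e => e' mub; rewrite cast_simplex_id.
elim: k mu e' mub => [|k IH] mu e' mub; first by rewrite cast_simplex_id.
have e1 : (k + n.+1 = (k + n).+1)%N by rewrite addnS.
have mb : (mu ord_max <= k + n)%N by rewrite addnC; exact: mub.
rewrite [iter_degen _ x]/= (cast_degen e1) -(loop_degen_tau _ mb).
rewrite -(IH (fun j => mu (widen_ord (leqnSn k) j))) //.
Qed.

Lemma cast_simplexM (X : sset) m n (e : m = n) (g h : loop X m) :
  cast_simplex (X := loopS X) e (g * h)%g =
  (cast_simplex (X := loopS X) e g * cast_simplex (X := loopS X) e h :> loop X n)%g.
Proof. by case: n / e. Qed.

Section ShuffleTerm.
Variables (X : sset) (q : nat) (h : loop X q).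

Definition shuffle_degen p (s : 'S_(p + q)) (x : X p.+1) : X (p + q).+1 :=
  cast_simplex (addnC q p.+1) (iter_degen (fun j => (shuffle_mu s j).+1) x).

Lemma shuffle_term_tau p (s : 'S_(p + q)) (x : X p.+1) (g : loop X p) :
  is_shuffle s ->
  shuffle_term s (tau x * g)%g h =
  (tau (shuffle_degen s x) * shuffle_term s g h)%g.
Proof.
move=> sh; rewrite /shuffle_term iter_degen_mul cast_simplexM mulgA.
congr (_ * _ * _)%g; apply: iter_degen_tau => j; exact: shuffle_mu_le.
Qed.

Lemma face1_shuffle_degen p (s : 'S_(p + q)) (x : X p.+2) : is_shuffle s ->
  face 1 (shuffle_degen (lift_shuffle s) x) = shuffle_degen s (face 1 x).
Proof.
move=> sh; apply: face_iter_degen_gt => j; first by rewrite shuffle_mu_lift.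
by rewrite /= addSn ltnS; exact: shuffle_mu_le.
Qed.

(** On the factor of [g], [d_0] passes all degeneracies, since the lifted [mu] is positive; on the
    factor of [h] it cancels the [s_0] given by the first entry of [nu]. *)
Lemma face0_shuffle_term p (s : 'S_(p + q)) (g : loop X p.+1) : is_shuffle s ->
  face (X := loopS X) 0 (shuffle_term (lift_shuffle s) g h) =
  shuffle_term s (face (X := loopS X) 0 g) h.
Proof.
move=> sh; rewrite [LHS]loop_faceM; congr (_ * _)%g.
  apply: (face_iter_degen_gt (Y := loopS X)) => j.
    by rewrite shuffle_mu_lift.
  exact: shuffle_mu_le.
apply: (face0_iter_degen (Y := loopS X)).
- exact: shuffle_nu_lift0.
- exact: shuffle_nu_lift.
- by move=> j; exact: shuffle_nu_le.
Qed.

Lemma shuffle_term1 (s : 'S_(0 + q)) : is_shuffle s ->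
  shuffle_term s (1%g : loop X 0) h = h.
Proof.
move=> sh; rewrite /shuffle_term iter_degen_one.
have -> : cast_simplex (X := loopS X) (addnC q 0) (1%g : loop X (q + 0)) =
    (1%g : loop X (0 + q)) by case: _ / (addnC q 0).
exact: mul1g.
Qed.

(** The type of [front i x] depends on [n], but [cobar X] does not, so front faces of simplices of
    different dimensions can be compared there. *)
Definition desusp_front i n (x : X n.+1) : cobar X := desusp (front i x).

Lemma desusp_front_cast i m n (e : m.+1 = n.+1) (x : X m.+1) :
  desusp_front i (cast_simplex e x) = desusp_front i x.
Proof. by case: (e) => e1; case: n / e1 e => e; rewrite cast_simplex_id. Qed.

Lemma desusp_front_degen_gt i c n (x : X n.+1) :
  (i <= n)%N -> (i < c <= n.+1)%N ->
  desusp_front i (degen c x) = desusp_front i x.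
Proof.
move=> ile ic; rewrite /desusp_front /front.
(* The number of faces also occurs in the type, so it is generalised before it becomes
   [(n - i).+1]. *)
move: (n.+1 - i)%N (subSn ile) => k ->.
by congr desusp; apply: iter_face_last_degen_top; lia.
Qed.

Lemma desusp_front_iter_degen i k n (mu : 'I_k -> nat) (x : X n.+1)
    (e : (k + n.+1 = (k + n).+1)%N) :
  (i <= n)%N -> (forall j, i < mu j <= n.+1 + j)%N ->
  desusp_front i (cast_simplex e (iter_degen mu x)) = desusp_front i x.
Proof.
move=> ile; elim: k mu e => [|k IH] mu e mub; first by rewrite desusp_front_cast.
have e1 : (k + n.+1 = (k + n).+1)%N by rewrite addnS.
have mb : (i < mu ord_max <= (k + n).+1)%N.
  by have := mub ord_max; rewrite /=; lia.
rewrite [iter_degen _ x]/= (cast_degen e1) desusp_front_degen_gt.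
- apply: (IH (fun j => mu (widen_ord (leqnSn k) j))) => j.
  exact: (mub (widen_ord _ j)).
- by rewrite (leq_trans ile) // leq_addl.
- exact: mb.
Qed.

(** If every [mu(j)] is at least [i], the degeneracies have indices above [i] and do not reach the
    front face. Otherwise some index [mu(j) + 1] is at most [i], and both copies of that vertex lie
    in the front face. *)
Lemma desusp_front_shuffle i p (s : 'S_(p + q)) (x : X p.+1) :
  is_shuffle s -> (i <= p + q)%N ->
  desusp_front i (shuffle_degen s x) =
  if (i <= p)%N && [forall j, i <= shuffle_mu s j]%N
  then desusp_front i x else 0.
Proof.
move=> sh ile; have [nuI muI] := is_shuffleP sh.
have [/forallP mui|/forallPn[j]] := boolP [forall j, i <= shuffle_mu s j]%N.
  (* The numbers below [i] all lie in [nu], which has only [p] entries. *)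
  have ip : (i <= p)%N.
    rewrite -(@shuffle_count p q s i) // [X in (_ + X)%N]big1 ?addn0.
      exact: sum_bool_le.
    by move=> j _; rewrite ltnNge mui.
  have e : (q + p.+1 = (q + p).+1)%N by rewrite addnS.
  rewrite ip /shuffle_degen.
  rewrite -[RHS](@desusp_front_iter_degen _ _ _
    (fun j => (shuffle_mu s j).+1) x e) //.
    rewrite (eq_irrelevance (addnC q p.+1) (etrans e (congr1 succn (addnC q p)))).
    by rewrite -cast_simplex_trans desusp_front_cast.
  by move=> j; rewrite !ltnS mui; exact: shuffle_mu_le.
rewrite -ltnNge andbF => ji.
have : degen_at (shuffle_mu s j).+1 (shuffle_degen s x).
  apply: degen_at_cast.
  apply: (@iter_degen_at_in _ _ _ (fun j => (shuffle_mu s j).+1)) => [i' j'|j'].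
    exact: muI.
  by rewrite addSn ltnS; exact: shuffle_mu_le.
move=> /degen_atP[z jn ->]; apply: desusp_degen; exact: front_degen.
Qed.

End ShuffleTerm.

(** * The sum over all shuffles and its recursion *)

Section ShuffleSum.
Variables (X : sset) (F : forall m, loop X m -> cobar X) (q : nat) (h : loop X q).

Local Notation face0 := (iter_face0 (X := loopS X)).

(** The sum [M g], with an abstract [F] in the role of [psi]. *)
Definition shuffle_sum p (g : loop X p) : cobar X :=
  \sum_(s : 'S_(p + q) | is_shuffle s) (-1) ^+ s * F (shuffle_term s g h).

(** Induction on [i]: removing the entry 0 from [nu] absorbs one [d_1] on the degenerate simplex and
    one [d_0] on the term. *)
Lemma shuffle_sum_iter_face i p (x : X p.+1) (g : loop X p) : (i <= p)%N ->
  \sum_(s : 'S_(p + q) | is_shuffle s && [forall j, i <= shuffle_mu s j]%N)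
    (-1) ^+ s * F (tau (iter_face1 i (shuffle_degen s x)) *
                   face0 i (shuffle_term s g h))%g =
  shuffle_sum (tau (iter_face1 i x) * face0 i g)%g.
Proof.
elim: i p x g => [|i IH] [|p] x g ip //.
- apply: eq_big => [s|s /andP[sh _]].
    by rewrite (_ : [forall j, _]) ?andbT //; apply/forallP.
  (* [iter_face0] and [iter_face1] match on the dimension first, so for [p = 0] they reduce only
     after [q] is split. *)
  by rewrite shuffle_term_tau //; case: q s h sh.
- apply: eq_big => [s|s /andP[sh _]].
    by rewrite (_ : [forall j, _]) ?andbT //; apply/forallP.
  by rewrite shuffle_term_tau.
rewrite -[RHS](IH p (face 1 x) (face (X := loopS X) 0 g)) //.
pose P (s : 'S_(p.+1 + q)) := is_shuffle s && [forall j, i < shuffle_mu s j]%N.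
have liftI : injective (@lift_shuffle p q).
  move=> s t /permP st; apply/permP => k; apply: (@lift_inj _ ord0).
  by have := st (lift ord0 k); rewrite !lift_perm_lift.
(* The sum is reindexed along [lift_shuffle]; positivity of [mu] is what forces 0 into [nu]. *)
have imP : [set s | P s] = [set lift_shuffle s | s in [set s : 'S_(p + q) |
    is_shuffle s && [forall j, i <= shuffle_mu s j]%N]].
  apply/setP => s; rewrite inE; apply/idP/imsetP.
    case/andP=> sh /forallP mus.
    have [|t st] := shuffle_lift_surj sh.
      by move=> j; exact: leq_ltn_trans (mus j).
    exists t => //; rewrite inE -is_shuffle_lift -st sh; apply/forallP => j.
    by rewrite -ltnS -shuffle_mu_lift -st.
  case=> t; rewrite inE => /andP[sh /forallP mut] ->.
  rewrite /P is_shuffle_lift sh; apply/forallP => j.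
  by rewrite shuffle_mu_lift ltnS.
transitivity (\sum_(s in [set s | P s]) (-1) ^+ s *
    F (tau (iter_face1 i.+1 (shuffle_degen s x)) *
       face0 i.+1 (shuffle_term s g h))%g).
  by apply: eq_bigl => s; rewrite inE.
rewrite imP big_imset /=; last by move=> s t _ _; exact: liftI.
apply: eq_big => [s|s]; first by rewrite inE.
rewrite inE => /andP[sh _].
rewrite face1_shuffle_degen // face0_shuffle_term //.
by rewrite /lift_shuffle odd_lift_perm.
Qed.

Hypothesis F_rec : forall n (x : X n.+1) (g : loop X n),
  F (tau x * g)%g = F g - \sum_(i < n.+1) desusp (front i x) *
    F (tau (iter_face1 i x) * face0 i g)%g.

(** The recursion for [F] is applied to every shuffle term and the sums are exchanged; each [i] then
    keeps only the shuffles with all [mu(j) >= i]. *)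
Lemma shuffle_sum_rec p (x : X p.+1) (g : loop X p) :
  shuffle_sum (tau x * g)%g = shuffle_sum g -
    \sum_(i < p.+1) desusp (front i x) *
      shuffle_sum (tau (iter_face1 i x) * face0 i g)%g.
Proof.
pose T (i : nat) (s : 'S_(p + q)) :=
  F (tau (iter_face1 i (shuffle_degen s x)) * face0 i (shuffle_term s g h))%g.
have -> : shuffle_sum (tau x * g)%g = shuffle_sum g -
    \sum_(s : 'S_(p + q) | is_shuffle s) \sum_(i < (p + q).+1)
      (-1) ^+ s * (desusp_front i (shuffle_degen s x) * T i s).
  rewrite /shuffle_sum -sumrB; apply: eq_bigr => s sh.
  by rewrite shuffle_term_tau // F_rec mulrBr mulr_sumr.
congr (_ - _); rewrite exchange_big /=.
(* The sum over [i] runs up to [p + q] on the left; its terms with [i > p] vanish, so the right-hand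
   sum is extended by zeros. *)
have le : (p.+1 <= (p + q).+1)%N by rewrite ltnS leq_addr.
rewrite (big_ord_widen _ (fun i => desusp (front i x) *
      shuffle_sum (tau (iter_face1 i x) * face0 i g)%g) le).
rewrite [RHS]big_mkcond; apply: eq_bigr => i _.
rewrite ltnS; case: ifP => ip; last first.
  apply: big1 => s sh; rewrite desusp_front_shuffle //; last exact: (ltn_ord i).
  by rewrite ip mul0r mulr0.
rewrite -shuffle_sum_iter_face // mulr_sumr [RHS]big_mkcondr.
apply: eq_bigr => s sh; rewrite desusp_front_shuffle //; last exact: (ltn_ord i).
rewrite ip /=; case: ifP => _; last by rewrite mul0r mulr0.
by rewrite !mulrA; congr (_ * _); exact/esym/commr_sign.
Qed.

Hypothesis F_one : F (1%g : loop X 0) = 1.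
Hypothesis F_degen : forall n (g : loop X n),
  degenerate (X := loopS X) g -> F g = 0.

Lemma shuffle_sum_mul p (g : loop X p) : shuffle_sum g = F g * F h.
Proof.
pose D m (a : loop X m) := shuffle_sum a - F a * F h.
suff D0 : D p g = 0 by apply/eqP; rewrite -subr_eq0; apply/eqP.
elim/ltn_ind: p g => p IH.
have D_tau (x : X p.+1) (a : loop X p) :
    (1 + desusp (edge x)) * D p (tau x * a)%g = D p a.
  have : D p (tau x * a)%g = D p a - \sum_(i < p.+1) desusp (front i x) *
      D (p - i)%N (tau (iter_face1 i x) * face0 i a)%g.
    rewrite {1}/D shuffle_sum_rec F_rec mulrBl mulr_suml.
    have subACA (u v w z : cobar X) : (u - v) - (w - z) = (u - w) - (v - z).
      by rewrite !opprB addrACA [RHS]addrACA [- v - w]addrC.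
    rewrite subACA -sumrB; congr (_ - _); apply: eq_bigr => i _.
    by rewrite /D mulrBr mulrA.
  (* The terms [i >= 1] vanish by [IH], as they have degree [p - i < p]. *)
  rewrite (psi_tailE D) (_ : psi_tail D x a = 0).
    by rewrite addr0 mulrDl mul1r => {1}->; rewrite subrK.
  by apply: big1 => i _; rewrite IH ?mulr0 //; have := ltn_ord i; lia.
elim/loop_ind => [|x a Da|x a Da].
(* Empty word: for [p = 0] the only shuffle is the identity and its term is [h]; for [p > 0] the
   simplex 1 is degenerate, and so are its shuffle terms. *)
- case: p {IH D_tau} => [|p].
    rewrite /D F_one mul1r /shuffle_sum.
    have unit_sh (s : 'S_(0 + q)) : is_shuffle s = (s == 1%g).
      apply/idP/eqP => [sh|->].
        apply/permP => k; rewrite perm1; apply: val_inj.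
        have := shuffle_mu_count (k : 'I_q) sh.
        rewrite big_ord0 addn0 => kE; rewrite [RHS]kE.
        by congr (val (fun_of_perm s _)); apply: val_inj.
      by apply: is_shuffleE => i j ij; rewrite /shuffle_nu /shuffle_mu !perm1.
    rewrite (big_pred1 1%g unit_sh) odd_perm1 mul1r shuffle_term1 ?subrr //.
    by rewrite unit_sh.
  have d1 : degenerate (X := loopS X) (1%g : loop X p.+1).
    have <- : loop_degen (0 : 'I_p.+1) (1%g : loop X p) = 1%g by exact: loop_degen1.
    exact: (Degenerate (X := loopS X)).
  rewrite /D (F_degen d1) mul0r subr0; apply: big1 => s sh.
  by rewrite F_degen ?mulr0 //; apply: shuffle_term_degen => //; left.
(* A letter [tau x] uses the inverse [xi] of the factor in [D_tau]; for an inverse letter, [D_tau]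
   is read from right to left. *)
- by rewrite -[LHS]mul1r -(xiM (edge x)) -mulrA D_tau Da mulr0.
- by rewrite -(D_tau x) mulKVg Da mulr0.
Qed.

End ShuffleSum.

(** * Biadditivity and reduction to simplices *)

Section ShuffleMulAdditive.
Variables (X : sset) (p q : nat).

Lemma shuffle_mul_zmodl (b : nchain (loopS X) q) :
  zmod_morphism (fun a : nchain (loopS X) p => shuffle_mul a b).
Proof. exact: freeg.lift_is_additive. Qed.

(** A degenerate [g] has chain 0; at a basis element the outer lift evaluates and leaves the inner
    lift, which is additive. *)
Lemma shuffle_mul_zmodr (g : loop X p) :
  zmod_morphism (shuffle_mul (q := q) (chain (X := loopS X) g)).
Proof.
have [[_ ->] b b'|[y _ ->] b b'] := chain_case (X := loopS X) g.
  have mul0 c : shuffle_mul 0 c = 0 :> nchain (loopS X) (p + q).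
    by have := shuffle_mul_zmodl c 0 0; rewrite !subrr.
  by rewrite !mul0 subrr.
by rewrite /shuffle_mul !freeg.liftU !scale1r; exact: freeg.lift_is_additive.
Qed.

End ShuffleMulAdditive.

Theorem proposition13 (X : sset) (hX : zero_reduced X) :
  graded_algebra_hom (psi X).
Proof.
have [psi_deg psi1 psi_rec] := psiP X; split=> // p q.
pose F m (g : loop X m) := psi X m (chain (X := loopS X) g).
have F_degen m (g : loop X m) : degenerate (X := loopS X) g -> F m g = 0.
  by move=> dg; rewrite /F chain_degen // raddf0.
have key (g : loop X p) (h : loop X q) :
    psi X (p + q) (shuffle_simplex g h) = F p g * F q h.
  rewrite -(shuffle_sum_mul h psi_rec) //.
  rewrite /shuffle_simplex raddf_sum; apply: eq_bigr => s _.
  by rewrite scaler_sign mulr_sign; case: ifP; rewrite ?raddfN.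
(* Packaged as additive maps, so that the inductions over chains can use the [raddf] lemmas in
   either argument. *)
pose mull b : {additive nchain (loopS X) p -> nchain (loopS X) (p + q)} :=
  HB.pack (fun a => shuffle_mul a b)
    (GRing.isZmodMorphism.Build _ _ _ (shuffle_mul_zmodl b)).
pose mulr g : {additive nchain (loopS X) q -> nchain (loopS X) (p + q)} :=
  HB.pack (shuffle_mul (chain (X := loopS X) g))
    (GRing.isZmodMorphism.Build _ _ _ (shuffle_mul_zmodr g)).
move=> a b; rewrite -[shuffle_mul a b]/(mull b a).
elim/nchain_ind: a => [|a a' IHa IHa'|a IHa|g].
- by rewrite !raddf0 mul0r.
- by rewrite !raddfD mulrDl IHa IHa'.
- by rewrite !raddfN mulNr IHa.
rewrite -[mull b _]/(mulr g b).
elim/nchain_ind: b => [|b b' IHb IHb'|b IHb|h].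
- by rewrite !raddf0 mulr0.
- by rewrite !raddfD mulrDr IHb IHb'.
- by rewrite !raddfN mulrN IHb.
by rewrite [mulr g _]shuffle_mul_chain; exact: key.
Qed.
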